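(* Let $q$ be a prime power, $n\ge 1$, and let $c\in \mathrm{GL}_n(\mathbb{F}_q)$ be regular elliptic. Then for every composition $\alpha=(\alpha_1,\ldots,\alpha_m)$ of $n$ (i.e. positive integers with $\sum_i\alpha_i=n$), the number $f_\alpha[e,c]$ of chains $e=c_0<c_1<\cdots<c_{m-1}<c_m=c$ in the absolute order on $\mathrm{GL}_n(\mathbb{F}_q)$ such that $\ell(c_i)=\alpha_1+\cdots+\alpha_i$ for each $i$ is \[ f_\alpha[e,c]=q^{\varepsilon(\alpha)}\cdot (q^n-1)^{m-1},\qquad \varepsilon(\alpha):=\sum_{i=1}^m(\alpha_i-1)(n-\alpha_i). \] In particular, for $1\le k\le n-1$ the number of elements of the interval $[e,c]$ of rank $k$ (i.e. with $\ell=k$) is $f_{(k,n-k)}[e,c]=q^{2k(n-k)-n}(q^n-1)$.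
   Context: Let $V=\mathbb{F}_q^n$. An element $g\in\mathrm{GL}(V)$ is a reflection if its fixed space $V^g=\{v\in V: gv=v\}$ has codimension $1$; let $T$ be the set of all reflections. For $g\in \mathrm{GL}(V)$, $\ell(g)$ is the minimum $\ell$ such that $g=t_1\cdots t_\ell$ with all $t_i\in T$ ($\ell(e)=0$). The absolute order is the partial order on $\mathrm{GL}(V)$ defined by $g\le h$ iff $\ell(g)+\ell(g^{-1}h)=\ell(h)$; $[e,c]=\{g: e\le g\le c\}$, and $g<h$ means $g\le h$, $g\neq h$. An element $c\in \mathrm{GL}_n(\mathbb{F}_q)$ is regular elliptic if it stabilizes no subspace of $\mathbb{F}_q^n$ other than $0$ and $\mathbb{F}_q^n$ (equivalently its characteristic polynomial is irreducible over $\mathbb{F}_q$); e.g. Singer cycles (images of generators of $\mathbb{F}_{q^n}^\times$ under $\mathbb{F}_{q^n}^\times\hookrightarrow \mathrm{GL}_{\mathbb{F}_q}(\mathbb{F}_{q^n})\cong\mathrm{GL}_n(\mathbb{F}_q)$).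
   Formalization: The formal theorem adds the assumption c ≠ e, which excludes only n = 1 with c = e; there c is regular elliptic by the definition, but for α = (1) there are 0 chains (since ℓ(e) = 0) while the formula gives 1. *)

(* Defs.v *)
From HB Require Import structures.
From mathcomp Require Import all_boot all_order all_fingroup all_algebra.

Set Implicit Arguments.
Unset Strict Implicit.
Unset Printing Implicit Defensive.

Import GroupScope GRing.Theory.
Local Open Scope ring_scope.

(* {'GL_n[F]} is the group of invertible matrices of size n.-1.+1, which is n
   as soon as 0 < n.  Its elements act on column vectors by v |-> g *m v, so
   that the group law (matrix product) is composition of maps. *)

Section AbsoluteOrder.

Variables (F : finFieldType) (n : nat).

Local Notation GL := {'GL_n[F]}.
Local Notation V := 'cV[F]_n.-1.+1.

Definition gl_lin (g : GL) : 'End(V) := linfun (mulmx (GLval g)).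

Definition reflection (g : GL) : bool :=
  (\dim {:V} - \dim (fixedSpace (gl_lin g)) == 1)%N.

Definition reflection_word (g : GL) (l : nat) : bool :=
  [exists t : l.-tuple GL, all reflection t && (g == (\prod_(x <- t) x)%g)].

Lemma reflection_rank1 (g : GL) (u : V) (w : 'rV[F]_n.-1.+1) :
  GLval g - 1%:M = u *m w -> u != 0 -> w != 0 -> reflection g.
Proof.
move=> gE u0 w0; rewrite /reflection.
have kE : \dim (limg (gl_lin g - \1%VF)) = 1%N.
  suff -> : limg (gl_lin g - \1%VF) = <[u]>%VS by rewrite dim_vline u0.
  have fE v : (gl_lin g - \1%VF) v = (w *m v) 0 0 *: u.
    rewrite add_lfunE opp_lfunE id_lfunE /gl_lin lfunE /= -[X in _ - X]mul1mx.
    by rewrite -mulmxBl gE -mulmxA [w *m v]mx11_scalar mul_mx_scalar !mxE eqxx.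
  apply/eqP; rewrite eqEsubv; apply/andP; split.
    by apply/subvP => x /memv_imgP[v _ ->]; rewrite fE memvZ // memv_line.
  have [j wj] : exists j, w 0 j != 0.
    apply/existsP; rewrite -negb_forall; apply: contra w0 => /forallP w0.
    by apply/eqP/rowP => j; rewrite mxE (eqP (w0 j)).
  have := memv_img (gl_lin g - \1%VF) (memvf (delta_mx j 0)).
  rewrite fE -colE mxE => H; rewrite -memvE.
  by rewrite -[u](scalerK wj) memvZ.
have := limg_ker_dim (gl_lin g - \1%VF) fullv.
by rewrite capfv -/(fixedSpace _) kE => <-; rewrite addKn.
Qed.

Lemma functional_neq0 (u1 u2 : V) : u1 != 0 -> u2 != 0 ->
  exists y : 'rV[F]_n.-1.+1, y *m u1 != 0 /\ y *m u2 != 0.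
Proof.
have aux (u : V) : u != 0 -> exists y : 'rV[F]_n.-1.+1, y *m u != 0.
  move=> u0; have [j uj] : exists j, u j 0 != 0.
    apply/existsP; rewrite -negb_forall; apply: contra u0 => /forallP u0.
    by apply/eqP/colP => j; rewrite mxE (eqP (u0 j)).
  exists (delta_mx 0 j); rewrite -rowE; apply: contra uj => /eqP/matrixP/(_ 0 0).
  by rewrite !mxE => ->.
move=> /aux[y1 y11] /aux[y2 y22].
have [y12|] := eqVneq (y1 *m u2) 0; last by exists y1.
have [y21|] := eqVneq (y2 *m u1) 0; last by exists y2.
by exists (y1 + y2); rewrite !mulmxDl y12 y21 addr0 add0r.
Qed.

Lemma reflection_step (g : GL) : g != 1%g ->
  exists t h : GL, [/\ reflection t, g = (t * h)%g
    & (\rank (GLval h - 1%:M)%R < \rank (GLval g - 1%:M)%R)%N].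
Proof.
move=> g1; set B := GLval g - 1%:M.
have gU : GLval g \in unitmx by exact: GL_unitmx.
have B0 : B != 0.
  apply: contra g1 => /eqP/subr0_eq gE; apply/eqP/val_inj; exact: gE.
have [j Bj] : exists j, col j B != 0.
  apply/existsP; rewrite -negb_forall; apply: contra B0 => /forallP B0.
  apply/eqP/matrixP => i j; have /eqP/colP/(_ i) := B0 j.
  by rewrite !mxE.
pose v : V := delta_mx j 0.
pose u : V := B *m v.
have u0 : u != 0 by rewrite /u -colE.
have gB : GLval g *m B = B *m GLval g.
  by rewrite mulmxBr mulmxBl mul1mx mulmx1.
have gVB : invmx (GLval g) *m B = B *m invmx (GLval g).
  by rewrite mulmxBr mulmxBl mulmxV // mulVmx // mul1mx mulmx1.
have u20 : invmx (GLval g) *m u != 0.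
  by apply: contra u0 => /eqP H; rewrite -(mulKVmx gU u) H mulmx0.
have [y0 [y0u y0u2]] := functional_neq0 u0 u20.
have sc (M : 'M[F]_1) : M != 0 -> M 0 0 != 0.
  by apply: contra => /eqP M0; rewrite [M]mx11_scalar M0 raddf0.
have a0 := sc _ y0u.
pose y := ((y0 *m u) 0 0)^-1 *: y0.
have yu : y *m u = 1%:M.
  rewrite /y -scalemxAl [y0 *m u]mx11_scalar scale_scalar_mx mxE eqxx mulr1n.
  by rewrite mulVf.
have yu2 : y *m (invmx (GLval g) *m u) != 0.
  by rewrite /y -scalemxAl scaler_eq0 negb_or y0u2 invr_eq0 a0.
pose M := GLval g - u *m (y *m B).
have MU : M \in unitmx.
  rewrite -unitmx_tr -row_free_unit -kermx_eq0; apply/eqP/row_matrixP => i.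
  rewrite row0; set z := row i _.
  have : z *m M^T = 0 by apply/sub_kermxP; exact: row_sub.
  move/(congr1 trmx); rewrite trmx_mul trmxK trmx0 => Mz.
  have gz : GLval g *m z^T = u *m (y *m B *m z^T).
    by apply/eqP; rewrite -subr_eq0 mulmxA -mulmxBl -/M Mz.
  set k := y *m B *m z^T in gz.
  have zE : z^T = invmx (GLval g) *m u *m k.
    by rewrite -mulmxA -gz mulKmx.
  have : k = y *m B *m (invmx (GLval g) *m u *m k) by rewrite -zE.
  have -> : y *m B *m (invmx (GLval g) *m u *m k) =
            k - y *m (invmx (GLval g) *m u) *m k.
    have Bu : B *m (invmx (GLval g) *m u) = u - invmx (GLval g) *m u.
      by rewrite mulmxBl mul1mx mulKVmx.
    rewrite [LHS]mulmxA -[y *m B *m (invmx _ *m u)]mulmxA Bu.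
    by rewrite mulmxBr mulmxBl yu mul1mx.
  move/eqP; rewrite -subr_eq0 opprB addrC subrK => /eqP H.
  have k0 : k = 0.
    have s0 := sc _ yu2.
    move: H; rewrite [y *m _]mx11_scalar mul_scalar_mx => /eqP.
    by rewrite scaler_eq0 (negPf s0) /= => /eqP.
  by rewrite -[z]trmxK zE k0 mulmx0 trmx0.
pose h : GL := Sub M MU.
have hE : GLval h = M by exact: SubK.
exists (g * h^-1)%g, h; split; last 1 first.
- rewrite hE /M addrAC -/B.
  have -> : B - u *m (y *m B) = (1%:M - u *m y) *m B.
    by rewrite mulmxBl mul1mx mulmxA.
  set P := _ *m B.
  have PB : (P <= B)%MS by exact: submxMl.
  have Pv : P *m v = 0.
    by rewrite /P -mulmxA -/u mulmxBl mul1mx -mulmxA yu mulmx1 subrr.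
  rewrite ltn_neqAle mxrankS // andbT; apply: contra u0.
  rewrite eqn_leq => /andP[_ PBr].
  have /submxP[Q BE] : (B <= P)%MS by rewrite -(geq_leqif (mxrank_leqif_sup PB)).
  by rewrite /u BE -mulmxA Pv mulmx0.
- apply: (@reflection_rank1 _ u (y *m B *m invmx M)) => //.
    rewrite GL_MxE GL_VxE hE.
    rewrite -[X in _ - X](mulmxV MU) -mulmxBl mulmxA; congr (_ *m _).
    by rewrite /M opprB addrC subrK.
  apply/eqP => /(congr1 (mulmx^~ M)); rewrite mulmxKV // mul0mx.
  move=> /(congr1 (mulmx^~ v)); rewrite -mulmxA -/u yu mul0mx.
  by move/matrixP/(_ 0 0); rewrite !mxE => /eqP; rewrite oner_eq0.
- by rewrite mulgKV.
Qed.

Lemma reflection_word_ex (g : GL) : exists l, reflection_word g l.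
Proof.
have [r] := ubnP (\rank (GLval g - 1%:M)%R); elim: r g => // r IHr g.
have [->|/reflection_step[t [h [tT -> lthg]]]] := eqVneq g 1%g.
  by exists 0; apply/existsP; exists [tuple]; rewrite big_nil eqxx.
rewrite ltnS => /(leq_trans lthg)/IHr[l /existsP[s /andP[sT /eqP hE]]].
exists l.+1; apply/existsP; exists [tuple of t :: s].
by rewrite /= tT sT big_cons -hE eqxx.
Qed.

Definition refl_length (g : GL) : nat := ex_minn (reflection_word_ex g).

Definition abs_le (g h : GL) : bool :=
  (refl_length g + refl_length (g^-1 * h)%g == refl_length h)%N.

Definition abs_lt (g h : GL) : bool := abs_le g h && (g != h).

Definition abs_interval (g h : GL) : {set GL} :=
  [set x | abs_le g x && abs_le x h].

Definition regular_elliptic (c : GL) : Prop :=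
  forall U : {vspace V}, (gl_lin c @: U <= U)%VS -> U = 0%VS \/ U = fullv.

Definition is_composition (m : nat) (a : m.-tuple nat) : bool :=
  [forall i, 0 < tnth a i]%N && (\sum_(i < m) tnth a i == n)%N.

(* A chain c_0 < ... < c_m is encoded as the function i |-> c_i on 'I_m.+1;
   the i-th step goes from widen_ord _ i (value i) to lift ord0 i
   (value i + 1). *)
Definition rank_chains (m : nat) (a : m.-tuple nat) (c : GL)
    : {set {ffun 'I_m.+1 -> GL}} :=
  [set x : {ffun 'I_m.+1 -> GL} |
    [&& x ord0 == 1%g, x ord_max == c,
        [forall i : 'I_m, abs_lt (x (widen_ord (leqnSn m) i)) (x (lift ord0 i))]
      & [forall i : 'I_m.+1,
           refl_length (x i) == (\sum_(j < m | j < i) tnth a j)%N]]].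

Definition flag_f (m : nat) (a : m.-tuple nat) (c : GL) : nat :=
  #|rank_chains a c|.

Definition eps (m : nat) (a : m.-tuple nat) : nat :=
  (\sum_(i < m) (tnth a i - 1) * (n - tnth a i))%N.

End AbsoluteOrder.

Arguments is_composition n {m} a.
Arguments eps n {m} a.

(* Main.v *)
Require Import Defs.
From mathcomp Require Import all_boot all_order all_fingroup all_algebra.
From mathcomp Require Import zify ring.

(* Write q for the size of F.  Since l(g) = rank (g - 1) and l(c) = n, the chains
   of type a are the factorizations c = g_1 ... g_m with rank (g_i - 1) = a_i.
   Their number is symmetric in a, because the rank is a class function, and
   everything follows from
     q^n f(a, b, ..) = q^(2ab) (q^n - 1) f(a + b, ..),
   which reduces to the splitting of r into 1 and r - 1.  For a fixed g of rank r
   the number of such splittings g = t g' is explicit up to the number of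
   eigenvectors of g in the image of g - 1, so the average of the latter over
   all factorizations c = g h, weighted by a class function of h, is needed.

   For that, replace c by all its conjugates and fix U = ker (g - 1), h and
   G = ker (h - 1); then U and G are complementary and the conjugates in
   question are those equal to h on U.  As c is irreducible, the number of
   conjugates of c with a prescribed restriction X to a subspace U depends only
   on dim U, provided that U contains no nonzero X-stable subspace.  Counting
   eigenvectors amounts to counting extensions of h from U to U + u with image
   of u in a given set; the bad extensions are described by the point at which a
   forward orbit under h first leaves U.  Conjugating h by a suitable
   transvection that depends on h moves the starting point of this orbit from
   z h + g to z h, and for the latter the exit point is independent of g. *)

Set Implicit Arguments.
Unset Strict Implicit.
Unset Printing Implicit Defensive.

Import GroupScope GRing.Theory.
Local Open Scope ring_scope.

(** * Row spaces and subspaces without stable subspaces *)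

Lemma card_row_space (F : finFieldType) (m n : nat) (A : 'M[F]_(m, n)) :
  #|[set x : 'rV_n | (x <= A)%MS]| = (#|F| ^ \rank A)%N.
Proof.
have -> : [set x : 'rV_n | (x <= A)%MS] =
    [set y *m row_base A | y : 'rV[F]_(\rank A)].
  apply/setP => x; rewrite inE; apply/idP/imsetP => [|[y _ ->]].
    by rewrite -(eq_row_base A) => /submxP[y ->]; exists y.
  by rewrite -(eq_row_base A) submxMl.
rewrite card_imset ?card_mx ?mul1n //.
by apply: row_free_inj; apply: row_base_free.
Qed.

Section Observability.

Variables (F : finFieldType) (N : nat).
Local Notation n := N.+1.
Implicit Types (U X Z : 'M[F]_n) (x y u w : 'rV[F]_n) (phi : 'cV[F]_n).

(** The term is that of control theory: if [U] is the kernel of an output map and [X] the evolution,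
    then no nonzero state has zero output forever. Square matrices [Z] suffice, as their row spaces
    are all the subspaces. *)
Definition observable U X :=
  [forall Z : 'M_n, (Z <= U)%MS && (Z *m X <= Z)%MS ==> (Z == 0)].

Lemma observableP U X :
  reflect (forall Z : 'M_n, (Z <= U)%MS -> (Z *m X <= Z)%MS -> Z = 0)
          (observable U X).
Proof.
apply: (iffP forallP) => [H Z ZU ZX|H Z].
  by apply/eqP; move: (H Z); rewrite ZU ZX.
by apply/implyP => /andP[ZU ZX]; apply/eqP/H.
Qed.

Lemma char_poly_expr X :
  exists a : 'I_n -> F, X ^+ n = \sum_(i < n) a i *: X ^+ i.
Proof.
have hZ i : horner_mx X ((char_poly X)`_i *: 'X^i) = (char_poly X)`_i *: X ^+ i.
  by rewrite linearZ /= rmorphXn /= horner_mx_X.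
have := Cayley_Hamilton X; rewrite -{1}[char_poly X]coefK.
rewrite poly_def size_char_poly raddf_sum big_ord_recr /= hZ => /eqP.
have := char_poly_monic X; rewrite monicE /lead_coef size_char_poly => /eqP /= ->.
rewrite scale1r addrC addr_eq0 => /eqP ->.
exists (fun i => - (char_poly X)`_i); rewrite -sumrN; apply: eq_bigr => i _.
by rewrite hZ scaleNr.
Qed.

(** By Cayley-Hamilton the span of [x, x X, .., x X^(n-1)] is stable under [X]; if it were contained
    in [U], observability would make it zero. *)
Lemma observable_exit U X x : observable U X -> x != 0 ->
  exists2 i, (i < n)%N & ~~ (x *m X ^+ i <= U)%MS.
Proof.
move=> /observableP obsUX x0.
have [|/existsPn H] := boolP [exists i : 'I_n, ~~ (x *m X ^+ i <= U)%MS].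
  by case/existsP => i; exists i.
have {}H (i : 'I_n) : (x *m X ^+ i <= U)%MS by have := H i; rewrite negbK.
pose K := \matrix_(i < n) (x *m X ^+ i).
suff K0 : K = 0.
  have xE : x = row ord0 K by rewrite rowK expr0 mulmx1.
  by move: x0; rewrite xE K0 row0 eqxx.
apply: obsUX; first by apply/row_subP => i; rewrite rowK.
apply/row_subP => i; rewrite row_mul rowK -mulmxA -[_ *m X]/(_ * X) -exprSr.
have [ltin|leni] := ltnP i.+1 n.
  by rewrite (_ : x *m _ = row (Ordinal ltin) K) ?row_sub // rowK.
have -> : i.+1 = n by apply/eqP; rewrite eqn_leq ltn_ord.
have [a ->] := char_poly_expr X; rewrite mulmx_sumr summx_sub // => j _.
by rewrite -scalemxAr scalemx_sub // (_ : x *m _ = row j K) ?row_sub // rowK.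
Qed.

End Observability.

(** * Extending a map defined on [U] to one more vector [u] *)

Section OneStepExtension.

Variables (F : finFieldType) (N : nat).
Local Notation n := N.+1.
Local Notation q := #|F|.

Variables (U X : 'M[F]_n) (u : 'rV[F]_n) (phi : 'cV[F]_n).
Hypotheses (Uphi : U *m phi = 0) (uphi : u *m phi = 1%:M).
Hypothesis obsUX : observable U X.

Implicit Types (A Z : 'M[F]_n) (a x y w v : 'rV[F]_n).

Local Notation ev x := ((x *m phi) 0 0).
Local Notation U' := (U + u)%MS.

Let ev_mul x : x *m phi = (ev x)%:M. Proof. exact: mx11_scalar. Qed.

Let evU x : (x <= U)%MS -> x *m phi = 0.
Proof. by case/submxP => y ->; rewrite -mulmxA Uphi mulmx0. Qed.

Let ev_lin (c : F) x y : ev (x - c *: y) = ev x - c * ev y.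
Proof. by rewrite mulmxBl -scalemxAl !mxE. Qed.

Let uU' : (u <= U')%MS. Proof. exact: addsmxSr. Qed.
Let UU' : (U <= U')%MS. Proof. exact: addsmxSl. Qed.

Let inU x : (x <= U')%MS -> ev x = 0 -> (x <= U)%MS.
Proof.
case/sub_addsmxP => -[a b] /= -> ev0.
have : (b *m u) *m phi = 0.
  have := ev_mul (a *m U + b *m u); rewrite ev0 raddf0 mulmxDl.
  by rewrite [a *m U *m _]evU ?submxMl // add0r.
by rewrite -mulmxA uphi mulmx1 => ->; rewrite mul0mx addr0 submxMl.
Qed.

Let inU1 x w : (x <= U')%MS -> (w <= U')%MS -> ev w = 1 ->
  (x - ev x *: w <= U)%MS.
Proof.
move=> xU wU ew; apply: inU; last by rewrite ev_lin ew mulr1 subrr.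
by rewrite addmx_sub // -scaleNr scalemx_sub.
Qed.

(** The matrices [X + phi *m y] agree with [X] on [U] and send [u] to [u *m X + y], so [y]
    parametrizes the extensions to [U + u] of the restriction of [X] to [U]. *)
Let mulX y x : x *m (X + phi *m y) = x *m X + ev x *: y.
Proof. by rewrite mulmxDr mulmxA {1}ev_mul mul_scalar_mx. Qed.

Let mulXU y x : (x <= U)%MS -> x *m (X + phi *m y) = x *m X.
Proof. by move=> xU; rewrite mulmxDr mulmxA evU // mul0mx addr0. Qed.

(* [A] is stable under every extension [X + phi *m y] of the restriction of [X]
   to [U] that maps [w] into [A]. *)
Let partial_inv w A := [&& w <= A, A <= U' & (A :&: U)%MS *m X <= A]%MS.

Definition inv_hull w : 'M[F]_n := (\sum_(A | partial_inv w A) A)%MS.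

(** Partial invariance passes to sums because every summand contains [w]: if a sum of vectors lies
    in [U], subtracting from each vector its [ev] times [w] moves it into [U] and leaves the sum
    unchanged, as the values of [ev] add up to 0. *)
Lemma partial_inv_hull w : (w <= U')%MS -> ev w = 1 -> partial_inv w (inv_hull w).
Proof.
move=> wU ew.
have Pw : partial_inv w <<w>>%MS.
  rewrite /partial_inv !genmxE submx_refl wU /=.
  suff -> : (<<w>> :&: U)%MS = 0 by rewrite mul0mx sub0mx.
  apply/eqP/rowV0P => x; rewrite sub_capmx genmxE => /andP[/sub_rVP[c ->] /evU].
  by rewrite -scalemxAl ev_mul ew scalemx1 => /matrixP/(_ 0 0);
    rewrite !mxE eqxx mulr1n => ->; rewrite scale0r.
have wH : (w <= inv_hull w)%MS.
  by apply: submx_trans (sumsmx_sup _ Pw (submx_refl _)); rewrite genmxE.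
rewrite /partial_inv wH /=; apply/andP; split.
  by apply/sumsmx_subP => A /and3P[].
apply/row_subP => i; rewrite row_mul; set a := row i _.
have := row_sub i (inv_hull w :&: U)%MS; rewrite -/a sub_capmx => /andP[].
case/sub_sumsmxP => b aE aU.
have bA A : partial_inv w A -> (b A *m A <= A)%MS by rewrite submxMl.
have PA A : partial_inv w A -> (b A *m A - ev (b A *m A) *: w <= A :&: U)%MS.
  move=> PA; have /and3P[wA AU _] := PA; rewrite sub_capmx; apply/andP; split.
    by rewrite addmx_sub ?bA // -scaleNr scalemx_sub.
  by rewrite inU1 // (submx_trans (bA _ PA)).
have -> : a = \sum_(A | partial_inv w A) (b A *m A - ev (b A *m A) *: w).
  rewrite sumrB -aE -scaler_suml.
  suff -> : \sum_(A | partial_inv w A) ev (b A *m A) = 0 by rewrite scale0r subr0.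
  have := evU aU; rewrite {1}aE mulmx_suml => /matrixP/(_ 0 0).
  by rewrite summxE mxE.
rewrite mulmx_suml summx_sub // => A PAw; apply: sumsmx_sup (PAw) _.
have /and3P[_ _ H] := PAw; apply: submx_trans H; exact: submxMr (PA A PAw).
Qed.

Lemma inv_hull_max w A : partial_inv w A -> (A <= inv_hull w)%MS.
Proof. by move=> PA; apply: sumsmx_sup PA _. Qed.

(** The conditions on [A] involve [w] only through [w <= A]. So the hull of [w] competes for the
    hull of [v], which therefore contains [w], and the roles can be exchanged. *)
Lemma inv_hull_eq w v : (w <= U')%MS -> ev w = 1 -> ev v = 1 ->
  (v <= inv_hull w)%MS -> (inv_hull v == inv_hull w)%MS.
Proof.
move=> wU ew ev1 vw.
have Pw := partial_inv_hull wU ew; have /and3P[ww wU' wX] := Pw.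
have vU := submx_trans vw wU'.
have hvw : (inv_hull w <= inv_hull v)%MS.
  by apply: inv_hull_max; rewrite /partial_inv vw wU' wX.
have /and3P[vv vU' vX] := partial_inv_hull vU ev1.
apply/andP; split=> //; apply: inv_hull_max.
by rewrite /partial_inv vU' vX (submx_trans ww hvw).
Qed.

Let hull_inv y w : (w <= U')%MS -> ev w = 1 ->
  (w *m (X + phi *m y) <= inv_hull w)%MS ->
  forall z : 'rV_n, (z <= inv_hull w)%MS -> (z *m (X + phi *m y) <= inv_hull w)%MS.
Proof.
move=> wU ew wX z zH; have /and3P[ww wU' wXU] := partial_inv_hull wU ew.
rewrite -[z](subrK (ev z *: w)) mulmxDl addmx_sub //; last first.
  by rewrite -scalemxAl scalemx_sub.
have zU : (z - ev z *: w <= U)%MS by apply: inU1 (submx_trans zH wU') wU ew.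
rewrite mulXU //; apply: submx_trans wXU; apply: submxMr.
by rewrite sub_capmx zU addmx_sub // -scaleNr scalemx_sub.
Qed.

(** A nonzero stable [Z] inside [U'] is not contained in [U], where the extension agrees with the
    observable [X]; hence [Z] contains some [w] with [ev w = 1] and lies in the hull of [w].
    Conversely, that hull is stable as soon as [w] is mapped into it. *)
Lemma unobservableP y :
  reflect (exists w, [/\ (w <= U')%MS, ev w = 1
                       & (w *m (X + phi *m y) <= inv_hull w)%MS])
          (~~ observable U' (X + phi *m y)).
Proof.
apply: (iffP forallPn) => [[Z]|[w [wU ew wX]]].
  rewrite negb_imply => /andP[/andP[ZU ZX] Z0].
  have [i ei] : exists i, ev (row i Z) != 0.
    apply/existsP; apply: contraR Z0 => /existsPn ev0.
    have ZleU : (Z <= U)%MS.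
      apply/row_subP => i; apply: inU; first exact: submx_trans (row_sub _ _) ZU.
      by apply/eqP; have := ev0 i; rewrite negbK.
    apply/eqP; move/observableP: obsUX; apply=> //.
    apply: submx_trans ZX; apply/row_subP => j; rewrite row_mul.
    by rewrite -(mulXU y) ?submxMr ?row_sub // (submx_trans (row_sub _ _)).
  pose w := (ev (row i Z))^-1 *: row i Z.
  have wZ : (w <= Z)%MS by rewrite scalemx_sub // row_sub.
  have ew : ev w = 1 by rewrite -scalemxAl mxE mulVf.
  exists w; split=> //; first exact: submx_trans wZ ZU.
  apply: (@submx_trans _ _ _ _ _ _ Z); first by rewrite (submx_trans _ ZX) ?submxMr.
  apply: inv_hull_max; rewrite /partial_inv wZ ZU /=.
  apply: submx_trans ZX; apply/row_subP => j; rewrite row_mul.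
  have := row_sub j (Z :&: U)%MS; rewrite sub_capmx => /andP[jZ jU].
  by rewrite -(mulXU y) // submxMr.
have /and3P[ww wU' wXU] := partial_inv_hull wU ew.
exists (inv_hull w); rewrite wU' /= negb_imply; apply/andP; split; last first.
  apply: contraTneq ww => ->; rewrite submx0; apply: contra_eq_neq ew => ->.
  by rewrite mul0mx mxE eq_sym oner_eq0.
by apply/row_subP => i; rewrite row_mul (hull_inv wU ew wX) ?row_sub.
Qed.

Definition slice m (A : 'M[F]_(m, n)) := [set w : 'rV[F]_n | (w <= A)%MS && (ev w == 1)].

Lemma card_slice m (A : 'M[F]_(m, n)) w : (w <= A)%MS -> ev w = 1 ->
  #|[set x : 'rV[F]_n | (x <= A)%MS]| =
  (q * #|slice A|)%N.
Proof.
move=> wA ew.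
pose f (p : F * 'rV[F]_n) : 'rV[F]_n := p.2 + (p.1 - 1) *: w.
have fE (p : F * 'rV[F]_n) : ev p.2 = 1 -> ev (f p) = p.1.
  by move=> e; rewrite /f -[X in X *: w]opprK scaleNr ev_lin e ew; ring.
rewrite -cardsT -cardsX -(card_in_imset (f := f)).
  apply: eq_card => x; rewrite inE; apply/idP/imsetP => [xA|[[c y]]].
    exists (ev x, x - (ev x - 1) *: w); last by rewrite /f /= subrK.
    rewrite !inE /= ev_lin ew mulr1 subKr eqxx andbT.
    by rewrite addmx_sub // -scaleNr scalemx_sub.
  by rewrite !inE /= => /andP[yA _] ->; rewrite addmx_sub // scalemx_sub.
move=> [c y] [d z]; rewrite !inE /= => /andP[_ /eqP ey] /andP[_ /eqP ez] fyz.
have cd : c = d by rewrite -[LHS](fE (c, y)) // fyz fE.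
by move: fyz; rewrite /f cd /= => /addIr ->.
Qed.

Lemma rank_extend : \rank U' = (\rank U).+1.
Proof.
have u0 : u != 0.
  apply: contraTneq (oner_neq0 F) => u0; have := uphi; rewrite u0 mul0mx.
  by move=> /matrixP/(_ 0 0); rewrite !mxE mulr1n => <-; rewrite eqxx.
rewrite mxrank_disjoint_sum ?rank_rV ?u0 ?addn1 //.
apply/eqP/rowV0P => x; rewrite sub_capmx => /andP[/evU ex /sub_rVP[c xE]].
move: ex; rewrite xE -scalemxAl uphi scalemx1 => /matrixP/(_ 0 0).
by rewrite !mxE eqxx mulr1n => ->; rewrite scale0r.
Qed.

Let evu : ev u = 1. Proof. by rewrite uphi mxE. Qed.

Lemma card_slice_extend : #|slice U'| = (q ^ \rank U)%N.
Proof.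
have /eqP := card_slice uU' evu.
rewrite card_row_space rank_extend expnS eqn_pmul2l.
  by move=> /eqP ->.
exact: ltnW (card_finNzRing_gt1 F).
Qed.

Local Notation hull_slice w := (slice (inv_hull w)).

Let hull_sliceE w v : w \in slice U' -> v \in hull_slice w ->
  v \in slice U' /\ hull_slice v = hull_slice w.
Proof.
rewrite !inE => /andP[wU /eqP ew] /andP[vw /eqP ev1].
have /and3P[_ wU' _] := partial_inv_hull wU ew.
split; first by rewrite (submx_trans vw) //= ev1 eqxx.
have /eqmxP vwE := inv_hull_eq wU ew ev1 vw.
by apply/setP => x; rewrite !inE vwE.
Qed.

Let card_hull_slice_gt0 w : w \in slice U' -> (0 < #|hull_slice w|)%N.
Proof.
rewrite inE => /andP[wU /eqP ew]; apply/card_gt0P; exists w.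
by rewrite inE ew eqxx andbT; case/and3P: (partial_inv_hull wU ew).
Qed.

Let sum_hull_slice w : w \in slice U' ->
  \sum_(v in hull_slice w) (#|hull_slice v|%:R^-1 : rat) = 1.
Proof.
move=> wU; rewrite (eq_bigr (fun=> #|hull_slice w|%:R^-1)); last first.
  by move=> v vw; have [_ ->] := hull_sliceE wU vw.
rewrite sumr_const -[LHS]mulr_natl mulfV //.
by rewrite Num.Theory.pnatr_eq0 -lt0n card_hull_slice_gt0.
Qed.

(** Partial invariance keeps the orbit of [x] in the hull as long as it has stayed in [U], so its
    first exit point is still in the hull. *)
Lemma hull_orbit w x i : w \in slice U' -> (x <= inv_hull w)%MS ->
  (forall j, (j < i)%N -> (x *m X ^+ j <= U)%MS) ->
  (x *m X ^+ i <= inv_hull w)%MS.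
Proof.
rewrite inE => /andP[wU /eqP ew] xw.
elim: i => [|i IH] H; first by rewrite expr0 mulmx1.
rewrite exprSr mulmxA; have /and3P[_ _] := partial_inv_hull wU ew.
apply: submx_trans; apply: submxMr.
by rewrite sub_capmx H // IH // => j ji; apply/H/ltnW.
Qed.

(** The span of the orbit up to its exit point [e] is partially invariant: a vector of this span
    that lies in [U] has no component along [e], so [X] maps it back into the span. *)
Lemma orbit_hull x d (e := x *m X ^+ d) :
  (forall j, (j < d)%N -> (x *m X ^+ j <= U)%MS) -> (e <= U')%MS -> ev e != 0 ->
  (x <= inv_hull ((ev e)^-1 *: e))%MS.
Proof.
move=> xU eU e0; pose K := \matrix_(j < d.+1) (x *m X ^+ j).
have Krow j : (j <= d)%N -> (x *m X ^+ j <= K)%MS.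
  move=> jd; rewrite (_ : x *m _ = row (Ordinal (jd : (j < d.+1)%N)) K) ?row_sub //.
  by rewrite rowK.
suff /inv_hull_max : partial_inv ((ev e)^-1 *: e) <<K>>%MS.
  apply: submx_trans; rewrite genmxE; have := Krow 0%N (leq0n d).
  by rewrite expr0 mulmx1.
rewrite /partial_inv !genmxE scalemx_sub ?Krow //=; apply/andP; split.
  apply/row_subP => j; rewrite rowK; have [jd|] := ltnP j d.
    exact: submx_trans (xU _ jd) UU'.
  by rewrite leq_eqVlt ltnNge -ltnS ltn_ord orbF => /eqP <-.
apply/row_subP => i; rewrite row_mul; set a := row i _.
have := row_sub i (<<K>> :&: U)%MS; rewrite -/a sub_capmx genmxE.
move=> /andP[/submxP[b aE] /evU aev].
move: aE; rewrite mulmx_sum_row big_ord_recr /= rowK -/e => aE.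
have b0 : b 0 ord_max = 0.
  move: aev; rewrite aE mulmxDl mulmx_suml big1 ?add0r => [|j _]; last first.
    by rewrite rowK -scalemxAl evU ?scaler0 //; apply: xU; exact: (ltn_ord j).
  rewrite -scalemxAl ev_mul scale_scalar_mx => /matrixP/(_ 0 0).
  by rewrite [LHS]mxE [RHS]mxE mulr1n => /eqP; rewrite mulf_eq0 (negPf e0) orbF => /eqP.
rewrite aE b0 scale0r addr0 mulmx_suml summx_sub // => j _.
by rewrite rowK -scalemxAl scalemx_sub // -mulmxA -[_ *m X]/(_ * X) -exprSr Krow ?(ltn_ord j).
Qed.

Section Count.

Variable S : {set 'rV[F]_n}.
Hypothesis S_inv : forall x a, (a <= U)%MS -> (x + a *m X \in S) = (x \in S).

Let bad y := ~~ observable U' (X + phi *m y).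

(* The vectors [w] witnessing that [y] is bad form a single class [hull_slice w],
   so weighting each by the inverse size of its class counts [y] once. *)
Let bad_slice y :
  (bad y)%:R = \sum_(w in slice U' | (w *m (X + phi *m y) <= inv_hull w)%MS)
     (#|hull_slice w|%:R^-1 : rat).
Proof.
have [/unobservableP[w0 [wU ew wX]]|ok] := boolP (bad y); last first.
  rewrite big_pred0 // => w; apply/negP => /andP[]; rewrite inE => /andP[wU /eqP ew] wX.
  by case/negP: ok; apply/unobservableP; exists w.
have w0U : w0 \in slice U' by rewrite inE wU ew eqxx.
rewrite -[LHS](sum_hull_slice w0U); apply: eq_bigl => v.
have /and3P[w0w0 wU' wXU] := partial_inv_hull wU ew.
have inv_w0 := hull_inv wU ew wX.
apply/idP/andP => [vw|[vU vX]].
  have [vU _] := hull_sliceE w0U vw; split=> //.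
  move: vw; rewrite inE => /andP[vw /eqP ev1].
  have /eqmxP -> := inv_hull_eq wU ew ev1 vw; exact: inv_w0.
move: (vU); rewrite !inE => /andP[vU1 /eqP ev1]; rewrite ev1 eqxx andbT.
have /and3P[vv vU' vXU] := partial_inv_hull vU1 ev1.
have inv_v := hull_inv vU1 ev1 vX.
(* For two witnesses the sum of their hulls is stable under [X + phi *m y], hence partially
   invariant at [w0], hence contained in the hull of [w0]. *)
suff /inv_hull_max : partial_inv w0 (inv_hull w0 + inv_hull v)%MS.
  by move=> H; apply: submx_trans vv (submx_trans (addsmxSr _ _) H).
rewrite /partial_inv (submx_trans w0w0 (addsmxSl _ _)) addsmx_sub wU' vU' /=.
apply/row_subP => i; rewrite row_mul.
have := row_sub i ((inv_hull w0 + inv_hull v) :&: U)%MS.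
rewrite sub_capmx => /andP[/sub_addsmxP[[a b] /= ->] zU].
rewrite -(mulXU y) // mulmxDl addmx_sub //.
  by apply: submx_trans (addsmxSl _ _); rewrite inv_w0 // submxMl.
by apply: submx_trans (addsmxSr _ _); rewrite inv_v // submxMl.
Qed.

(** As [w - u] lies in [U] and [S] is a union of cosets of [U *m X], the condition on the image of
    [u] is the same condition on the image [w *m X + y] of [w], which determines [y]. *)
Let card_ext_slice w : w \in slice U' ->
  #|[set y | (u *m X + y \in S) && (w *m (X + phi *m y) <= inv_hull w)%MS]| =
  #|[set x in S | (x <= inv_hull w)%MS]|.
Proof.
rewrite inE => /andP[wU /eqP ew]; rewrite -(card_imset _ (addrI (w *m X))).
apply: eq_card => x; rewrite !inE; apply/imsetP/andP => [[y]|[xS xw]].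
  rewrite inE mulX ew scale1r => /andP[yS yw] ->; split=> //.
  have -> : w *m X + y = u *m X + y + (w - u) *m X.
    by rewrite mulmxBl [RHS]addrC addrA subrK.
  rewrite S_inv //; apply: inU; first by rewrite addmx_sub // eqmx_opp.
  by rewrite -[u]scale1r ev_lin ew evu mulr1 subrr.
exists (x - w *m X); last by rewrite addrCA subrr addr0.
rewrite inE mulX ew scale1r [w *m X + _]addrCA subrr addr0 xw andbT.
have -> : u *m X + (x - w *m X) = x + (u - w) *m X.
  by rewrite mulmxBl addrCA.
rewrite S_inv //; apply: inU; first by rewrite addmx_sub // eqmx_opp.
by rewrite -[w]scale1r ev_lin ew evu mulr1 subrr.
Qed.

Lemma card_unobservable :
  (#|[set y | (u *m X + y \in S) && ~~ observable U' (X + phi *m y)]|%:R : rat) =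
  \sum_(w in slice U') #|[set x in S | (x <= inv_hull w)%MS]|%:R / #|hull_slice w|%:R.
Proof.
transitivity (\sum_(y | u *m X + y \in S) ((bad y)%:R : rat)).
  rewrite -sum1_card natr_sum; under eq_bigl do rewrite inE.
  rewrite big_mkcondr /=; apply: eq_bigr => y _.
  by rewrite /bad; case: (observable _ _).
under eq_bigr do rewrite bad_slice.
rewrite (exchange_big_dep (mem (slice U'))) /=; last by move=> y w _ /andP[].
apply: eq_bigr => w wU; rewrite -(card_ext_slice wU).
rewrite sumr_const -[LHS]mulr_natl; congr (_%:R / _); apply: eq_card => y.
by rewrite !inE; move: wU; rewrite inE => ->.
Qed.

End Count.

(** When [S] is the whole space, each [w] contributes the quotient of the sizes of its hull and of
    the slice [ev = 1] of it, which is [q]. *)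
Lemma card_unobservable_extensions :
  #|[set y | ~~ observable U' (X + phi *m y)]| = (q ^ (\rank U).+1)%N.
Proof.
have setT_inv x a : (a <= U)%MS -> (x + a *m X \in [set: 'rV_n]) = (x \in [set: 'rV_n]).
  by rewrite !inE.
have := card_unobservable setT_inv.
rewrite (eq_bigr (fun=> q%:R)) => [|w wU].
  rewrite sumr_const card_slice_extend -mulrnA -expnS => /eqP.
  rewrite Num.Theory.eqr_nat => /eqP <-; apply: eq_card => y.
  by rewrite !inE.
have := wU; rewrite inE => /andP[wU1 /eqP ew].
have /and3P[ww _ _] := partial_inv_hull wU1 ew.
have -> : [set x in [set: 'rV_n] | (x <= inv_hull w)%MS] =
    [set x | (x <= inv_hull w)%MS] by apply/setP => x; rewrite !inE.
rewrite (card_slice ww ew) natrM mulfK //.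
by rewrite Num.Theory.pnatr_eq0 -lt0n card_hull_slice_gt0.
Qed.

(** For [x] in [S], which is nonzero, the orbit under [X] has a first exit point from [U]. Every
    hull that contains [x] contains this point, and its normalization determines the hull. So the
    [w] with [x] in their hull form one class, of total weight 1. *)
Lemma card_unobservable_in (S : {set 'rV[F]_n}) :
  (forall x a, (a <= U)%MS -> (x + a *m X \in S) = (x \in S)) -> 0 \notin S ->
  #|[set y | (u *m X + y \in S) && ~~ observable U' (X + phi *m y)]| =
  #|[set x in S | [exists w in slice U', x <= inv_hull w]%MS]|.
Proof.
move=> S_inv S0; apply/eqP; rewrite -(Num.Theory.eqr_nat rat) card_unobservable //.
rewrite (eq_bigr (fun w => \sum_(x in S | (x <= inv_hull w)%MS) #|hull_slice w|%:R^-1));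
  last first.
  move=> w _; rewrite sumr_const -[RHS]mulr_natl; congr (_%:R / _).
  by apply: eq_card => x; rewrite !inE.
rewrite (exchange_big_dep (mem S)) /=; last by move=> w x _ /andP[].
apply/eqP; transitivity (\sum_(x in S) ([exists w in slice U', x <= inv_hull w]%MS)%:R : rat);
  last first.
  rewrite -sum1_card natr_sum; under [RHS]eq_bigl do rewrite inE.
  by rewrite big_mkcondr /=; apply: eq_bigr => x _; case: ifP.
apply: eq_bigr => x xS; rewrite xS /=.
have [/exists_inP[w0 w0U xw0]|/exists_inPn H] :=
  boolP [exists w in slice U', x <= inv_hull w]%MS; last first.
  by rewrite big_pred0 // => w; apply/negP => /andP[/H /negP].
rewrite -[RHS](sum_hull_slice w0U); apply: eq_bigl => v.
have := w0U; rewrite inE => /andP[w0U1 /eqP ew0].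
apply/andP/idP => [[vU xv]|vw]; last first.
  have [vU _] := hull_sliceE w0U vw; split=> //.
  move: vw; rewrite inE => /andP[vw /eqP ev1].
  by have /eqmxP -> := inv_hull_eq w0U1 ew0 ev1 vw.
have := vU; rewrite inE => /andP[vU1 /eqP ev1].
have x0 : x != 0 by apply: contraNneq S0 => xE; rewrite -xE.
have [i _ Hi] := observable_exit obsUX x0.
have ex : exists j, ~~ (x *m X ^+ j <= U)%MS by exists i.
case: (ex_minnP ex) => {Hi i ex} i xi xmin.
have xU j : (j < i)%N -> (x *m X ^+ j <= U)%MS.
  by move=> ji; apply: contraLR ji => /xmin; rewrite -leqNgt.
have ew := hull_orbit w0U xw0 xU; have ev' := hull_orbit vU xv xU.
set e := x *m X ^+ i in xi ew ev'.
have /and3P[_ wU' _] := partial_inv_hull w0U1 ew0.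
have e0 : ev e != 0 by apply: contra xi => /eqP; apply: inU (submx_trans ew wU').
have ee : ev ((ev e)^-1 *: e) = 1 by rewrite -scalemxAl mxE mulVf.
have [|_ <-] := @hull_sliceE w0 ((ev e)^-1 *: e) w0U.
  by rewrite inE scalemx_sub //= ee eqxx.
have [|_ ->] := @hull_sliceE v ((ev e)^-1 *: e) vU.
  by rewrite inE scalemx_sub //= ee eqxx.
by rewrite inE ev1 eqxx andbT; case/and3P: (partial_inv_hull vU1 ev1).
Qed.

End OneStepExtension.

(** * Conjugates of [c] with a prescribed restriction *)

Lemma ex_functional (F : fieldType) (n : nat) (U : 'M[F]_n) : (\rank U < n)%N ->
  exists u : 'rV[F]_n, exists phi : 'cV[F]_n, U *m phi = 0 /\ u *m phi = 1%:M.
Proof.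
move=> rU; have K0 : cokermx U != 0.
  by rewrite -mxrank_eq0 mxrank_coker subn_eq0 -ltnNge.
have /existsP[i /existsP[j Kij]] : [exists i, exists j, cokermx U i j != 0].
  apply: contraR K0 => /existsPn H; apply/eqP/matrixP => i j; rewrite [RHS]mxE.
  by apply/eqP; have := H i; apply: contraR => Kij; apply/existsP; exists j.
move: (mulmx_coker U) Kij; move: (cokermx U) => K UK Kij.
exists ((K i j)^-1 *: delta_mx 0 i), (col j K); split.
  by rewrite colE mulmxA UK mul0mx.
rewrite -scalemxAl -rowE; apply/matrixP => a b; rewrite !mxE !ord1 eqxx.
by rewrite mulVf.
Qed.

Section Completions.

Variables (F : finFieldType) (N : nat).
Local Notation n := N.+1.
Local Notation q := #|F|.
Local Notation GL := {'GL_N.+1[F]}.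
Implicit Types (U X Z : 'M[F]_n) (x y u w : 'rV[F]_n) (phi : 'cV[F]_n).

(* Subspaces are row spaces, on which [g] acts by [v |-> v *m g]; the rank of
   [g - 1] is the same for this action and for the one on columns. *)
Definition mx_of (g : GL) : 'M[F]_n := GLval g.

Lemma mx_ofM (g h : GL) : mx_of (g * h)%g = mx_of g *m mx_of h.
Proof. by []. Qed.

Lemma mx_of1 : mx_of 1%g = 1%:M.
Proof. by []. Qed.

Lemma mx_ofV (g : GL) : mx_of g^-1%g = invmx (mx_of g).
Proof. by rewrite /mx_of GL_VxE. Qed.

Lemma mx_of_unit (g : GL) : mx_of g \in unitmx.
Proof. exact: (GL_unit g). Qed.

Lemma mx_of_inj : injective mx_of.
Proof. exact: val_inj. Qed.

Lemma mx_of_ex (A : 'M[F]_n) : A \in unitmx -> exists g : GL, mx_of g = A.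
Proof. by move=> Au; exists (Sub A Au : GL); rewrite /mx_of SubK. Qed.

Definition irreducible_mx (A : 'M[F]_n) :=
  forall Z : 'M[F]_n, (Z *m A <= Z)%MS -> Z = 0 \/ \rank Z = n.

Lemma irreducible_conj (c k : GL) :
  irreducible_mx (mx_of c) -> irreducible_mx (mx_of (c ^ k)%g).
Proof.
move=> irr Z; rewrite conjgE !mx_ofM mx_ofV !mulmxA.
move=> /(submxMr (invmx (mx_of k))); rewrite mulmxK ?mx_of_unit // => ZX.
have [/(congr1 (mulmx^~ (mx_of k)))|] := irr _ ZX.
  by rewrite mulmxKV ?mx_of_unit // mul0mx; left.
by rewrite mxrankMfree ?row_free_unit ?unitmx_inv ?mx_of_unit //; right.
Qed.

(** The conjugating elements [k] are counted, not the conjugates, so each conjugate occurs once for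
    every element of the centralizer of [c]. The kernel condition says that [c ^ k] and [X] agree on
    [U]. *)
Definition completions (c : GL) U X :=
  [set k : GL | (U <= kermx (mx_of (c ^ k)%g - X))%MS].

Variable c : GL.
Hypothesis c_irr : irreducible_mx (mx_of c).

(** An [X]-stable subspace of [U] is also stable under the irreducible [c ^ k], and it is proper. *)
Lemma completion_observable U X k : (\rank U < n)%N ->
  k \in completions c U X -> observable U X.
Proof.
move=> rU; rewrite inE => /sub_kermxP UX; apply/observableP => Z /[dup] ZU.
case/submxP => D ZD ZX.
have ZE : Z *m mx_of (c ^ k)%g = Z *m X.
  by apply/eqP; rewrite -subr_eq0 -mulmxBr ZD -mulmxA UX mulmx0.
have [|//|rZ] := irreducible_conj (k := k) c_irr (Z := Z); first by rewrite ZE.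
by have := mxrankS ZU; rewrite rZ leqNgt rU.
Qed.

Lemma card_completions_in U X u phi (S : {set 'rV[F]_n}) :
  U *m phi = 0 -> u *m phi = 1%:M ->
  #|[set k in completions c U X | u *m mx_of (c ^ k)%g \in S]| =
  (\sum_(y | (u *m X + y)%R \in S)
     #|completions c (U + u)%MS (X + phi *m y)%R|)%N.
Proof.
move=> Up up; pose y (k : GL) : 'rV[F]_n := u *m (mx_of (c ^ k)%g - X).
have yE k : u *m X + y k = u *m mx_of (c ^ k)%g.
  by rewrite /y mulmxBr addrC subrK.
rewrite -sum1_card (partition_big y (fun y => u *m X + y \in S)) /=; last first.
  by move=> k; rewrite inE yE => /andP[].
apply: eq_bigr => z zS.
rewrite -sum1_card; apply: eq_bigl => k; rewrite !inE addsmx_sub opprD addrA.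
have -> : (U <= kermx (mx_of (c ^ k)%g - X - phi *m z))%MS =
          (U <= kermx (mx_of (c ^ k)%g - X))%MS.
  by rewrite !sub_kermx mulmxBr mulmxA Up mul0mx subr0.
rewrite -andbA; congr (_ && _); rewrite sub_kermx [u *m (_ - phi *m z)]mulmxBr [u *m (phi *m z)]mulmxA up mul1mx subr_eq0.
by rewrite andb_idl // => /eqP yk; rewrite -yE yk.
Qed.

(* Normal form of a pair [(U, X)] with [U] an observable hyperplane, in the basis
   [w, w X, .., w X^N] where [w, .., w X^(N-1)] span [U]. *)
Definition shift_completions := [set k : GL |
  [forall i : 'I_N, row (widen_ord (leqnSn N) i) (mx_of (c ^ k)%g) ==
                    row (lift ord0 i) 1%:M]].

Lemma card_completions_hyperplane U X : observable U X -> \rank U = N ->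
  #|completions c U X| = #|shift_completions|.
Proof.
move=> obsUX rU.
have [|u [phi [Uphi uphi]]] := @ex_functional F n U; first by rewrite rU.
have phi_ker : (U :=: kermx phi)%MS.
  apply/eqmxP; have Uk : (U <= kermx phi)%MS by apply/sub_kermxP.
  rewrite -(geq_leqif (mxrank_leqif_eq Uk)) mxrank_ker rU.
  suff -> : \rank phi = 1%N by rewrite subn1.
  apply/eqP; rewrite eqn_leq rank_leq_col lt0n mxrank_eq0.
  by apply: contra_eq_neq uphi => ->; rewrite mulmx0 eq_sym oner_eq0.
have inU x : (x <= U)%MS = (x *m phi == 0) by rewrite phi_ker sub_kermx.
(* Such a [w] solves [N] homogeneous linear equations in [N + 1] unknowns. By observability
   [w *m X ^+ N] is then outside [U]. *)
have [w w0 wU] : exists2 w : 'rV[F]_n, w != 0 & forall j, (j < N)%N -> (w *m X ^+ j <= U)%MS.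
  pose K := \matrix_(i < n, j < N) (X ^+ j *m phi) i 0.
  have /rowV0Pn[w wK w0] : kermx K != 0.
    by rewrite -mxrank_eq0 mxrank_ker subn_eq0 -ltnNge ltnS rank_leq_col.
  exists w => // j jN; rewrite inU -mulmxA; apply/eqP/matrixP => a b; rewrite !ord1.
  have /sub_kermxP/matrixP/(_ 0 (Ordinal jN)) wKj := wK.
  transitivity ((w *m K) 0 (Ordinal jN)); last by rewrite wKj !mxE.
  by rewrite [LHS]mxE [RHS]mxE; apply: eq_bigr => i _; rewrite [K _ _]mxE.
have hX (v : 'rV_n) i j : v *m X ^+ i *m X ^+ j = v *m X ^+ (i + j).
  by rewrite -mulmxA -[X ^+ i *m _]/(X ^+ i * X ^+ j) -exprD.
pose a := (w *m X ^+ N *m phi) 0 0.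
have a0 : a != 0.
  have [i lti nU] := observable_exit obsUX w0.
  have iN : i = N.
    by apply/eqP; rewrite eqn_leq -ltnS lti leqNgt; apply: contra nU; exact: wU.
  move: nU; rewrite inU iN; apply: contra => /eqP aE.
  by apply/eqP/matrixP => i' j'; rewrite !ord1 [LHS]aE mxE.
have wphi j : (j < N)%N -> (w *m X ^+ j *m phi) 0 0 = 0.
  by move=> /wU; rewrite inU => /eqP ->; rewrite mxE.
pose R := \matrix_(i < n) (w *m X ^+ i).
have RE (v : 'rV[F]_n) : v *m R = \sum_i v 0 i *: (w *m X ^+ i).
  by rewrite mulmx_sum_row; apply: eq_bigr => i _; rewrite rowK.
have Ru : R \in unitmx.
  rewrite -row_free_unit -kermx_eq0; apply/eqP/row_matrixP => i0; rewrite row0.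
  set v := row i0 _; have vR : v *m R = 0 by apply/sub_kermxP; exact: row_sub.
  apply/eqP; apply: contraT => v0.
  have [i1 vi1] : exists i, v 0 i != 0.
    apply/existsP; apply: contraR v0 => /existsPn H; apply/eqP/rowP => i.
    by rewrite [RHS]mxE; have := H i; rewrite negbK => /eqP.
  (* Let [m] be the last index with nonzero coefficient in a relation between the rows of [R]. After
     multiplication by [X ^+ (N - m)], [phi] kills every term but the [m]-th, where it takes the
     value [a] times the coefficient. *)
  case: (@arg_maxnP _ i1 (fun i => v 0 i != 0) val vi1) => m vm mmax.
  have := congr1 (fun x : 'rV_n => (x *m X ^+ (N - m) *m phi) 0 0) vR.
  rewrite RE !mulmx_suml !mul0mx summxE (bigD1 m) //= big1 ?addr0.
    rewrite -!scalemxAl hX subnKC; last by rewrite -ltnS.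
    rewrite mxE [RHS]mxE => /eqP.
    by rewrite -/a mulf_eq0 (negPf vm) (negPf a0).
  move=> i im; have [ltim|leim] := ltnP i m.
    rewrite -!scalemxAl hX mxE wphi ?mulr0 //.
    by have := ltn_ord m; lia.
  have /eqP -> : v 0 i == 0.
    apply: contraTT im => vi; rewrite negbK -val_eqE eqn_leq leim andbT.
    exact: mmax.
  by rewrite scale0r !mul0mx mxE.
have [r rE] := mx_of_ex Ru.
(* [c ^ (k * r^-1)] is the matrix of [c ^ k] in the basis formed by the rows of [R], so right
   translation by [r] identifies the two sets. *)
rewrite -[RHS](card_imset _ (mulIg r)); apply: eq_card => k.
have -> : (k \in [set k' * r | k' in shift_completions]%g) =
          ((k * r^-1)%g \in shift_completions).
  by apply/imsetP/idP => [[k' ? ->]|?]; [rewrite mulgK | exists (k * r^-1)%g; rewrite ?mulgKV].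
rewrite !inE.
have rowR (i : 'I_N) : row (widen_ord (leqnSn N) i) R *m X = row (lift ord0 i) R.
  by rewrite !rowK -mulmxA -[_ *m X]/(_ * X) -exprSr.
have eqv (i : 'I_N) : (row (widen_ord (leqnSn N) i) (mx_of (c ^ (k * r^-1))%g) ==
                    row (lift ord0 i) 1%:M) =
      (row (widen_ord (leqnSn N) i) R <= kermx (mx_of (c ^ k)%g - X))%MS.
  rewrite sub_kermx mulmxBr subr_eq0 rowR.
  rewrite conjgM conjgE invgK !mx_ofM mx_ofV rE.
  have -> : row (lift ord0 i) 1%:M = row (lift ord0 i) R *m invmx R.
    by rewrite -row_mul mulmxV.
  by rewrite mulmxA row_mul (can_eq (mulmxKV Ru)) row_mul.
apply/idP/forallP => [UX i|H].
  rewrite eqv; apply: submx_trans UX.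
  by rewrite rowK; apply: wU; exact: (ltn_ord i).
apply/row_subP => j; set x := row j U.
have xE : x = x *m invmx R *m R by rewrite mulmxKV.
move: (x *m invmx R) xE => v xE.
have vN : v 0 ord_max = 0.
  have : x *m phi = 0 by apply/eqP; rewrite -inU row_sub.
  rewrite xE RE mulmx_suml big_ord_recr /= => /matrixP/(_ 0 0).
  rewrite mxE summxE big1 => [|i _]; last by rewrite -scalemxAl mxE wphi ?mulr0 /=.
  by rewrite add0r -scalemxAl mxE [RHS]mxE -/a => /eqP; rewrite mulf_eq0 (negPf a0) orbF => /eqP.
rewrite xE RE big_ord_recr /= vN scale0r addr0 summx_sub // => i _.
by rewrite scalemx_sub //; have := H i; rewrite eqv rowK.
Qed.

(** Induction on the codimension of [U]: the completions are sorted by the image of one further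
    vector. Unobservable extensions have no completion; the [q^n - q^(rank U + 1)] observable ones
    all have the same number of them. *)
Lemma card_completions U X : observable U X -> (\rank U < n)%N ->
  #|completions c U X| =
  (#|shift_completions| * \prod_((\rank U).+1 <= i < n) (q ^ n - q ^ i))%N.
Proof.
have [m] := ubnP (n - \rank U); elim: m U X => // m IH U X lem obsUX rU.
have [rUN|rUN] := eqVneq (\rank U) N.
  by rewrite rUN big_geq // muln1 card_completions_hyperplane.
have rU1 : (\rank U < N)%N by rewrite ltn_neqAle rUN -ltnS.
have [u [phi [Uphi uphi]]] := ex_functional rU.
have rU' := rank_extend Uphi uphi.
have := card_completions_in X setT Uphi uphi.
under eq_bigl do rewrite inE.
have -> : [set k in completions c U X | u *m mx_of (c ^ k)%g \in setT] = completions c U X.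
  by apply/setP => k; rewrite !inE andbT.
move=> ->.
rewrite (bigID (fun y => observable (U + u)%MS (X + phi *m y))) /=.
rewrite [X in (_ + X)%N]big1 ?addn0 => [|y /negP nobs]; last first.
  apply: eq_card0 => k; apply/negP => /completion_observable H; apply/nobs/H.
  by rewrite rU' ltnS.
rewrite (eq_bigr (fun=> (#|shift_completions| *
    \prod_((\rank U).+2 <= i < n) (q ^ n - q ^ i))%N)) => [|y oy]; last first.
  rewrite IH ?rU' ?ltnS //; lia.
rewrite (eq_bigl (fun y => y \in [set y | observable (U + u)%MS (X + phi *m y)]));
  last by move=> y; rewrite inE.
rewrite sum_nat_const [in RHS]big_ltn // mulnCA; congr (_ * (_ * _))%N.
have := cardsC [set y | ~~ observable (U + u)%MS (X + phi *m y)].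
rewrite card_unobservable_extensions // card_mx mul1n => <-.
by rewrite addKn; apply: eq_card => y; rewrite !inE negbK.
Qed.

End Completions.

(** * Conjugation by transvections that depend on [h] *)

Lemma hankel_solution (F : fieldType) (d : nat) (t : nat -> F) :
  (forall i, (i < d)%N -> t i = 0) -> t d = 1 ->
  exists p : 'rV[F]_d.+1,
    forall i : 'I_d.+1, \sum_j p 0 j * t (i + j)%N = (val i == 0%N)%:R.
Proof.
move=> t0 t1; pose H := \matrix_(i < d.+1, j < d.+1) t (i + j)%N.
have HE (v : 'rV_d.+1) i : (v *m H) 0 i = \sum_j v 0 j * t (i + j)%N.
  by rewrite mxE; apply: eq_bigr => j _; rewrite mxE addnC.
(* [H] is 0 above its antidiagonal and 1 on it: if [m] is the last nonzero coordinate of [v], then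
   the entry of [v *m H] in column [d - m] is [v 0 m]. The required [p] is the first row of the
   inverse. *)
have Hu : H \in unitmx.
  rewrite -row_free_unit -kermx_eq0; apply/eqP/row_matrixP => i0; rewrite row0.
  set v := row i0 _; have vH : v *m H = 0 by apply/sub_kermxP; exact: row_sub.
  apply/eqP; apply: contraT => v0.
  have [i1 vi1] : exists i, v 0 i != 0.
    apply/existsP; apply: contraR v0 => /existsPn H0; apply/eqP/rowP => i.
    by rewrite [RHS]mxE; have := H0 i; rewrite negbK => /eqP.
  case: (@arg_maxnP _ i1 (fun i => v 0 i != 0) val vi1) => m vm mmax.
  have := HE v (rev_ord m); rewrite vH (bigD1 m) //= big1 ?addr0.
    rewrite mxE subSS subnK ?t1 ?mulr1 -1?ltnS // => vE.
    by rewrite -vE eqxx in vm.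
  move=> i im; have [ltim|leim] := ltnP i m.
    by rewrite t0 ?mulr0 // subSS; have := ltn_ord m; lia.
  have /eqP -> : v 0 i == 0; last by rewrite mul0r.
  apply: contraTT im => vi; rewrite negbK -val_eqE eqn_leq leim andbT.
  exact: mmax.
exists (delta_mx 0 ord0 *m invmx H) => i.
by rewrite -HE mulmxKV // mxE eqxx.
Qed.

Section UnipotentTwist.

Variables (F : finFieldType) (N : nat).
Local Notation n := N.+1.
Local Notation GL := {'GL_N.+1[F]}.
Local Notation mx g := (@mx_of F N g).

Lemma conj_transvection (h k : GL) (xi : 'cV[F]_n) (g : 'rV[F]_n) :
  g *m mx h = g -> g *m xi = 0 -> mx k = 1%:M - xi *m g ->
  mx (h ^ k)%g = mx h - (mx h - 1%:M) *m xi *m g.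
Proof.
move=> gh gxi kE; set D := _ *m xi *m g.
have gD : g *m D = 0 by rewrite /D !mulmxA mulmxBr gh mulmx1 subrr !mul0mx.
have DE : D = mx h *m (xi *m g) - xi *m g by rewrite /D -mulmxA mulmxBl mul1mx.
have : mx k *m (mx h - D) = mx k *m mx (h ^ k)%g.
  rewrite -mx_ofM -conjgC mx_ofM kE mulmxBl mul1mx -mulmxA mulmxBr gh gD subr0.
  by rewrite mulmxBr mulmx1 DE -addrA -opprD subrK.
by move/(congr1 (mulmx (invmx (mx k)))); rewrite !mulKmx ?mx_of_unit.
Qed.

Section Shear.

Variables (X : 'M[F]_n) (theta : 'cV[F]_n) (g : 'rV[F]_n) (d : nat) (a : 'I_d -> F).
Hypotheses (gX : g *m X = g) (gtheta : g *m theta = 0).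

Let xi := \sum_(j < d) a j *: (X ^+ j *m theta).
Let Y := X + (X - 1%:M) *m xi *m g.

Let gXj j : g *m X ^+ j = g.
Proof. by elim: j => [|j IH]; rewrite ?expr0 ?mulmx1 // exprSr mulmxA IH. Qed.

Lemma shear_ker : g *m xi = 0.
Proof.
rewrite mulmx_sumr big1 // => j _.
by rewrite -scalemxAr mulmxA gXj gtheta scaler0.
Qed.

(** The correction term of [Y] begins by applying [g], which kills every [X ^+ j *m theta] because
    [g] is fixed by [X] and [g *m theta = 0]. *)
Lemma shear_expr j : Y ^+ j *m theta = X ^+ j *m theta.
Proof.
elim: j => [|j IH]; first by rewrite !expr0.
have YE (v : 'cV_n) : Y *m v = X *m v + (X - 1%:M) *m xi *m (g *m v).
  by rewrite /Y mulmxDl -!mulmxA.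
have exprE (A : 'M[F]_n) : A ^+ j.+1 *m theta = A *m (A ^+ j *m theta).
  by rewrite exprS mulmxA.
by rewrite !exprE IH YE [g *m _]mulmxA gXj gtheta mulmx0 addr0.
Qed.

(** A [Y]-stable subspace of [U] is killed by all [Y ^+ j *m theta = X ^+ j *m theta], hence by
    [(X - 1) xi]; on it [Y] and [X] agree. *)
Lemma shear_observable U : U *m theta = 0 -> observable U X -> observable U Y.
Proof.
move=> Ut /observableP obs; apply/observableP => Z ZU ZY; apply: obs => //.
have ZYj j : (Z *m Y ^+ j <= Z)%MS.
  elim: j => [|j IH]; first by rewrite expr0 mulmx1.
  by rewrite exprSr mulmxA; apply: submx_trans ZY; apply: submxMr.
have ZXj j : Z *m (X ^+ j *m theta) = 0.
  rewrite -shear_expr mulmxA; case/submxP: (ZYj j) => D ->.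
  by case/submxP: ZU => E ->; rewrite -!mulmxA Ut !mulmx0.
have Zxi : Z *m ((X - 1%:M) *m xi) = 0.
  rewrite !mulmx_sumr big1 // => j _; rewrite -!scalemxAr.
  have -> : (X - 1%:M) *m (X ^+ j *m theta) = X ^+ j.+1 *m theta - X ^+ j *m theta.
    by rewrite mulmxBl mul1mx exprS mulmxA.
  by rewrite mulmxBr !ZXj subrr scaler0.
by move: ZY; rewrite mulmxDr mulmxA Zxi mul0mx addr0.
Qed.

End Shear.

(** The candidates for the second factor [h] of a conjugate of [c], when [U] and [G] are to be the
    fixed spaces of the first and of the second factor. *)
Definition fixing_observable (U G : 'M[F]_n) :=
  [set h : GL | (G <= kermx (mx h - 1%:M))%MS && observable U (mx h)].

Definition exits_at (U X : 'M[F]_n) (x : 'rV[F]_n) d (y : 'rV[F]_n) :=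
  [forall j : 'I_d, (x *m X ^+ j <= U)%MS] && (x *m X ^+ d == y).

Lemma exits_atP U X x d y :
  reflect ((forall j, (j < d)%N -> (x *m X ^+ j <= U)%MS) /\ x *m X ^+ d = y)
          (exits_at U X x d y).
Proof.
apply: (iffP andP) => [[/forallP H /eqP yE]|[H yE]]; split=> //.
- by move=> j jd; exact: (H (Ordinal jd)).
- by apply/forallP => j; apply: H.
- by apply/eqP.
Qed.

Section ExitSwap.

Variables (U G : 'M[F]_n) (d : nat) (y z g : 'rV[F]_n) (theta : 'cV[F]_n).
Hypotheses (zU : (z <= U)%MS) (gG : (g <= G)%MS).
Hypotheses (Ut : U *m theta = 0) (gt : g *m theta = 0) (yt : y *m theta = 1%:M).

Let moment (h : GL) i := (z *m (mx h ^+ i *m theta)) 0 0.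
Let moment_step h i := moment h i.+1 - moment h i.

Let solves h (p : 'rV[F]_d.+1) :=
  [forall i : 'I_d.+1, \sum_j p 0 j * moment_step h (i + j) == (val i == 0%N)%:R].

(** The choice depends on [h] only through the columns [h^j theta], which the twist preserves, so
    [h] and its twist choose the same coefficients. If the system has no solution, the value is 0
    and the twist is trivial. *)
Let coef h : 'rV[F]_d.+1 := odflt 0 [pick p | solves h p].

Let xi h := \sum_(j < d.+1) coef h 0 j *: (mx h ^+ j *m theta).

Let twist h : GL := insubd (1%g : GL) (1%:M - xi h *m g).

Let fix_g h : h \in fixing_observable U G -> g *m mx h = g.
Proof.
rewrite inE => /andP[Gh _]; apply/eqP; rewrite -subr_eq0.
by have := submx_trans gG Gh; rewrite sub_kermx mulmxBr mulmx1.
Qed.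

Let twistE h : g *m mx h = g -> mx (twist h) = 1%:M - xi h *m g.
Proof.
move=> gh; rewrite /twist /mx_of val_insubd; case: ifP => // /negP[].
have gx : g *m xi h = 0 by apply: shear_ker.
have : (1%:M - xi h *m g) *m (1%:M + xi h *m g) = 1%:M.
  rewrite mulmxBl mul1mx mulmxDr mulmx1 -mulmxA [g *m _]mulmxA gx mul0mx mulmx0.
  by rewrite addr0 addrK.
by case/mulmx1_unit.
Qed.

Let twistVE h : g *m mx h = g -> mx (twist h)^-1%g = 1%:M - (- xi h) *m g.
Proof.
move=> gh; have gx : g *m xi h = 0 by apply: shear_ker.
rewrite mx_ofV twistE // mulNmx opprK.
have E : (1%:M - xi h *m g) *m (1%:M + xi h *m g) = 1%:M.
  rewrite mulmxBl mul1mx mulmxDr mulmx1 -mulmxA [g *m _]mulmxA gx mul0mx mulmx0.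
  by rewrite addr0 addrK.
have [Eu _] := mulmx1_unit E.
by rewrite -[RHS](mulKmx Eu) E mulmx1.
Qed.

Let fwd h := (h ^ twist h)%g.
Let bwd h := (h ^ (twist h)^-1)%g.

Let fwdE h : g *m mx h = g ->
  mx (fwd h) = mx h + (mx h - 1%:M) *m (\sum_(j < d.+1) - coef h 0 j *: (mx h ^+ j *m theta)) *m g.
Proof.
move=> gh; rewrite (conj_transvection gh _ (twistE gh)); last exact: shear_ker.
congr (_ + _); rewrite -mulNmx -mulmxN; congr (_ *m _ *m _).
by rewrite -sumrN; apply: eq_bigr => j _; rewrite scaleNr.
Qed.

Let bwdE h : g *m mx h = g ->
  mx (bwd h) = mx h + (mx h - 1%:M) *m xi h *m g.
Proof.
move=> gh; rewrite (conj_transvection gh _ (twistVE gh)).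
  by rewrite mulmxN mulNmx opprK.
by rewrite mulmxN shear_ker // oppr0.
Qed.

Let twist_eq h h' : (forall j, mx h' ^+ j *m theta = mx h ^+ j *m theta) ->
  twist h' = twist h.
Proof.
move=> E; have mE i : moment_step h' i = moment_step h i.
  by rewrite /moment_step /moment !E.
have cE : coef h' = coef h.
  congr odflt; apply: eq_pick => p; apply: eq_forallb => i.
  by under eq_bigr do rewrite mE.
by rewrite /twist /xi cE; under eq_bigr do rewrite E.
Qed.

Let fwdK h : g *m mx h = g -> bwd (fwd h) = h.
Proof.
move=> gh; rewrite /bwd (@twist_eq h) /fwd ?conjgK // => j.
by rewrite -/(fwd h) fwdE // shear_expr.
Qed.

Let bwdK h : g *m mx h = g -> fwd (bwd h) = h.
Proof.
move=> gh; rewrite /fwd (@twist_eq h) /bwd ?conjgKV // => j.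
by rewrite -/(bwd h) bwdE // shear_expr.
Qed.

Let shear_fixing h h' (a : 'I_d.+1 -> F) : h \in fixing_observable U G ->
  mx h' = mx h + (mx h - 1%:M) *m (\sum_(j < d.+1) a j *: (mx h ^+ j *m theta)) *m g ->
  h' \in fixing_observable U G.
Proof.
move=> hF h'E; have gh := fix_g hF; move: hF; rewrite !inE => /andP[Gh obs].
rewrite h'E shear_observable // andbT addrAC sub_kermx mulmxDr !mulmxA.
by move: Gh; rewrite sub_kermx => /eqP ->; rewrite !mul0mx addr0.
Qed.

(** The Hankel system says that the functional [(h - 1) xi] is 1 at [z] and 0 at [z h, .., z h^d].
    This is why the twist changes the image of [z] by [g] but not the rest of the orbit up to time
    [d]. *)
Let coefP h : (forall i, (i < d)%N -> moment h i.+1 = 0) -> moment h d.+1 = 1 ->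
  forall i : 'I_d.+1,
    z *m mx h ^+ i *m ((mx h - 1%:M) *m xi h) = (val i == 0%N)%:R%:M.
Proof.
move=> m0 m1 i.
have mz : moment h 0 = 0.
  rewrite /moment expr0 mul1mx; case/submxP: zU => D ->.
  by rewrite -mulmxA Ut mulmx0 mxE.
have mi j : (j <= d)%N -> moment h j = 0 by case: j => // j; exact: m0.
have /forallP/(_ i)/eqP <- : solves h (coef h).
  rewrite /coef; case: pickP => //= none.
  have [||p pP] := @hankel_solution F d (moment_step h).
  - by move=> j jd; rewrite /moment_step m0 // mi ?subrr // ltnW.
  - by rewrite /moment_step m1 mi // subr0.
  by have /negP[] := none p; apply/forallP => j; rewrite pP.
rewrite [LHS]mx11_scalar; congr (_%:M).
rewrite !mulmx_sumr summxE; apply: eq_bigr => j _.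
rewrite -!scalemxAr mxE; congr (_ * _).
have -> : (mx h - 1%:M) *m (mx h ^+ j *m theta) =
    mx h ^+ j.+1 *m theta - mx h ^+ j *m theta.
  by rewrite mulmxBl mul1mx exprS mulmxA.
rewrite mulmxBr /moment_step /moment -!mulmxA ![mx h ^+ i *m (_ *m _)]mulmxA.
rewrite -[mx h ^+ i *m mx h ^+ j]/(mx h ^+ i * mx h ^+ j).
rewrite -[mx h ^+ i *m mx h ^+ j.+1]/(mx h ^+ i * mx h ^+ j.+1).
by rewrite -!exprD addnS [LHS]mxE [X in _ + X]mxE.
Qed.

Let momentE h i : moment h i = (z *m mx h ^+ i *m theta) 0 0.
Proof. by rewrite /moment mulmxA. Qed.

Let theta0 (x : 'rV[F]_n) : (x <= U)%MS -> x *m theta = 0.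
Proof. by case/submxP => D ->; rewrite -mulmxA Ut mulmx0. Qed.

Let stepX h i : z *m mx h *m mx h ^+ i = z *m mx h ^+ i.+1.
Proof. by rewrite exprS mulmxA. Qed.

Let fwd_exit h : h \in fixing_observable U G ->
  exits_at U (mx h) (z *m mx h) d y ->
  (fwd h \in fixing_observable U G) && exits_at U (mx (fwd h)) (z *m mx (fwd h) + g) d y.
Proof.
move=> hF /exits_atP[hU hy]; have gh := fix_g hF.
rewrite (shear_fixing hF (fwdE gh)) /=.
have cP := @coefP h.
have {}cP : forall i : 'I_d.+1,
    z *m mx h ^+ i *m ((mx h - 1%:M) *m xi h) = (val i == 0%N)%:R%:M.
  apply: cP => [i id|]; rewrite momentE -stepX.
    by rewrite theta0 ?hU // mxE.
  by rewrite hy yt mxE.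
have hE : mx (fwd h) = mx h - (mx h - 1%:M) *m xi h *m g.
  by rewrite (conj_transvection gh _ (twistE gh)) //; exact: shear_ker.
have step i : (i <= d)%N ->
    z *m mx h ^+ i *m mx (fwd h) = z *m mx h ^+ i.+1 - (i == 0%N)%:R *: g.
  move=> id; rewrite hE mulmxBr exprSr !mulmxA; congr (_ - _).
  rewrite -[_ *m (mx h - 1%:M) *m xi h]mulmxA (cP (Ordinal (id : (i < d.+1)%N))).
  by rewrite mul_scalar_mx.
have x0 : z *m mx (fwd h) + g = z *m mx h.
  by have := step 0%N (leq0n _); rewrite expr0 mulmx1 expr1 scale1r => ->; rewrite subrK.
have xj j : (j <= d)%N -> z *m mx h *m mx (fwd h) ^+ j = z *m mx h *m mx h ^+ j.
  elim: j => [|j IH] jd; first by rewrite !expr0.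
  by rewrite exprSr mulmxA IH ?(ltnW jd) // stepX step // scale0r subr0 stepX.
rewrite x0; apply/exits_atP; split=> [j jd|]; last by rewrite xj.
by rewrite xj ?(ltnW jd) // hU.
Qed.

Let bwd_exit h : h \in fixing_observable U G ->
  exits_at U (mx h) (z *m mx h + g) d y ->
  (bwd h \in fixing_observable U G) && exits_at U (mx (bwd h)) (z *m mx (bwd h)) d y.
Proof.
move=> hF /exits_atP[hU hy]; have gh := fix_g hF.
have gX j : g *m mx h ^+ j = g.
  by elim: j => [|j IH]; rewrite ?expr0 ?mulmx1 // exprSr mulmxA IH.
rewrite (shear_fixing hF (bwdE gh)) /=.
have cP : forall i : 'I_d.+1,
    z *m mx h ^+ i *m ((mx h - 1%:M) *m xi h) = (val i == 0%N)%:R%:M.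
  (* As [h] fixes [g] and [theta] kills [g], the orbits of [z h] and [z h + g] have the same
     moments. *)
  have mE i : moment h i.+1 = ((z *m mx h + g) *m mx h ^+ i *m theta) 0 0.
    by rewrite momentE -stepX mulmxDl mulmxDl gX gt addr0.
  by apply: coefP => [i id|]; rewrite mE ?hy ?yt ?theta0 ?hU // mxE.
have x0 : z *m mx (bwd h) = z *m mx h + g.
  rewrite bwdE // mulmxDr; congr (_ + _); rewrite mulmxA.
  by have := cP ord0; rewrite expr0 mulmx1 => ->; rewrite mul1mx.
have xj j : (j <= d)%N ->
    (z *m mx h + g) *m mx (bwd h) ^+ j = (z *m mx h + g) *m mx h ^+ j.
  elim: j => [|j IH] jd; first by rewrite !expr0.
  rewrite exprSr mulmxA IH ?(ltnW jd) // bwdE // mulmxDr exprSr [RHS]mulmxA.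
  rewrite -[RHS]addr0; congr (_ + _); rewrite mulmxA.
  suff -> : (z *m mx h + g) *m mx h ^+ j *m ((mx h - 1%:M) *m xi h) = 0.
    by rewrite mul0mx.
  rewrite mulmxDl gX stepX mulmxDl (cP (Ordinal (jd : (j.+1 < d.+1)%N))) /=.
  by rewrite raddf0 add0r mulmxA mulmxBr gh mulmx1 subrr mul0mx.
rewrite x0; apply/exits_atP; split=> [j jd|]; last by rewrite xj.
by rewrite xj ?(ltnW jd) // hU.
Qed.

(* [h] is sent to its conjugate by the transvection [1 - xi g], where [xi] lies in
   the span of the [h^j theta] with coefficients chosen such that the new [z h]
   is [z h - g] while the rest of the orbit up to time [d] is unchanged.  The
   inverse conjugation uses the same [xi], as [h^j theta] is unchanged too. *)
Lemma exit_swap (Phi : GL -> nat) : (forall h k, Phi (h ^ k)%g = Phi h) ->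
  (\sum_(h in fixing_observable U G | exits_at U (mx h) (z *m mx h) d y) Phi h =
  \sum_(h in fixing_observable U G | exits_at U (mx h) (z *m mx h + g) d y) Phi h)%N.
Proof.
move=> PhiJ; rewrite [RHS](reindex_onto fwd bwd) /=; last first.
  by move=> h /andP[hF _]; rewrite bwdK // fix_g.
apply: eq_big => h; last by rewrite /fwd PhiJ.
apply/andP/andP => [[hF hx]|[/andP[hF hx] /eqP hE]].
  by rewrite fwd_exit // fwdK // fix_g.
by have := bwd_exit hF hx; rewrite hE => /andP.
Qed.

End ExitSwap.

End UnipotentTwist.

(** * The first exit of an orbit from [U] *)

Lemma separating_functional (F : fieldType) (m n : nat) (A : 'M[F]_(m, n)) (y : 'rV[F]_n) :
  ~~ (y <= A)%MS -> exists phi : 'cV[F]_n, A *m phi = 0 /\ y *m phi = 1%:M.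
Proof.
rewrite submxE => yA; have : A *m cokermx A = 0 by apply: mulmx_coker.
move: (cokermx A) yA => K yK AK.
have [j yj] : exists j, (y *m K) 0 j != 0.
  apply/existsP; apply: contraR yK => /existsPn H; apply/eqP/rowP => j.
  by rewrite [RHS]mxE; have := H j; rewrite negbK => /eqP.
exists (((y *m K) 0 j)^-1 *: col j K); split.
  by rewrite -scalemxAr colE mulmxA AK mul0mx scaler0.
rewrite -scalemxAr colE mulmxA -colE; apply/matrixP => a b; rewrite !ord1.
by rewrite mxE [col _ _ _ _]mxE mulVf // mxE.
Qed.

Section LateExit.

Variables (F : finFieldType) (N : nat).
Local Notation n := N.+1.
Local Notation q := #|F|.
Local Notation GL := {'GL_N.+1[F]}.
Local Notation mx g := (@mx_of F N g).
Implicit Types (U G X : 'M[F]_n) (x y z g : 'rV[F]_n).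

(* As [y] lies outside [U], it is the first exit point of the orbit of [x]. *)
Definition exits_off (U X : 'M[F]_n) (x g : 'rV[F]_n) :=
  [exists d : 'I_n, exists y, ~~ (y <= U + g)%MS && exits_at U X x d y].

Lemma exits_at_uniq U X x d y d' y' : ~~ (y <= U)%MS -> ~~ (y' <= U)%MS ->
  exits_at U X x d y -> exits_at U X x d' y' -> d = d' /\ y = y'.
Proof.
move=> yU yU' /exits_atP[H yE] /exits_atP[H' yE'].
suff dd : d = d' by split=> //; rewrite -yE -yE' dd.
have [dd|dd|//] := ltngtP d d'.
  by move: yU; rewrite -yE H'.
by move: yU'; rewrite -yE' H.
Qed.

Lemma exits_offE U X x g :
  exits_off U X x g =
  (\sum_(d < n) \sum_(y | ~~ (y <= U + g)%MS) exits_at U X x d y)%N :> nat.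
Proof.
have sub y : ~~ (y <= U + g)%MS -> ~~ (y <= U)%MS.
  by apply: contra => /submx_trans; apply; apply: addsmxSl.
have [/existsP[d /existsP[y /andP[yUg xy]]]|/existsPn no] := boolP (exits_off _ _ _ _).
  rewrite (bigD1 d) //= (bigD1 y) //= xy !big1 // => [i id|i /andP[iU iy]].
    apply: big1 => z zU; apply/eqP; rewrite eqb0; apply: contra id => xz.
    by have [/val_inj -> _] := exits_at_uniq (sub _ zU) (sub _ yUg) xz xy.
  apply/eqP; rewrite eqb0; apply: contra iy => xz.
  by have [_ ->] := exits_at_uniq (sub _ iU) (sub _ yUg) xz xy.
rewrite big1 // => d _; apply: big1 => y yU; apply/eqP; rewrite eqb0.
by apply: contra (no d) => xy; apply/existsP; exists y; rewrite yU.
Qed.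

Lemma exits_offZ U X x g (c : F) : c != 0 ->
  exits_off U X x (c *: g) = exits_off U X x g.
Proof.
move=> c0; apply: eq_existsb => d; apply: eq_existsb => y; congr (~~ _ && _).
by rewrite (adds_eqmx (eqmx_refl U) (eqmx_scale g c0)).
Qed.

(** Both sides are split by the exit time [d] and the exit point [y]. As [y] is outside [U + g],
    some functional [theta] kills [U] and [g] and is 1 at [y], which is what [exit_swap] asks
    for. *)
Lemma sum_exits_off_swap (Phi : GL -> nat) U G z g :
  (forall h k, Phi (h ^ k)%g = Phi h) -> (z <= U)%MS -> (g <= G)%MS ->
  (\sum_(h in fixing_observable U G) Phi h * exits_off U (mx h) (z *m mx h + g) g =
   \sum_(h in fixing_observable U G) Phi h * exits_off U (mx h) (z *m mx h) g)%N.
Proof.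
move=> PhiJ zU gG.
under eq_bigr => h _ do rewrite exits_offE big_distrr /=.
under [RHS]eq_bigr => h _ do rewrite exits_offE big_distrr /=.
rewrite exchange_big [RHS]exchange_big; apply: eq_bigr => d _.
under eq_bigr => h _ do rewrite big_distrr /=.
under [RHS]eq_bigr => h _ do rewrite big_distrr /=.
rewrite exchange_big [RHS]exchange_big; apply: eq_bigr => y yU.
have [theta [/eqP]] := separating_functional yU.
rewrite -sub_kermx addsmx_sub !sub_kermx => /andP[/eqP Ut /eqP gt] yt.
have bigE (P : pred GL) : (\sum_(h in fixing_observable U G) Phi h * P h =
    \sum_(h in fixing_observable U G | P h) Phi h)%N.
  by rewrite big_mkcondr; apply: eq_bigr => h _; case: (P h); rewrite ?muln1 ?muln0.
by rewrite !bigE (exit_swap d zU gG Ut gt yt PhiJ).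
Qed.

Lemma exits_off_first U X x g : observable U X -> x != 0 ->
  exists d y, [/\ exits_at U X x d y, ~~ (y <= U)%MS
                & exits_off U X x g = ~~ (y <= U + g)%MS].
Proof.
move=> obs x0; have [i ltin Hi] := observable_exit obs x0.
have ex : exists j, ~~ (x *m X ^+ j <= U)%MS by exists i.
case: (ex_minnP ex) => d xd dmin; have dn : (d < n)%N by apply: leq_ltn_trans ltin; exact: dmin.
have xy : exits_at U X x d (x *m X ^+ d).
  apply/exits_atP; split=> // j jd; apply: contraLR jd => /dmin.
  by rewrite -leqNgt.
exists d, (x *m X ^+ d); split=> //.
apply/existsP/idP => [[d' /existsP[y /andP[yU xy']]]|yU].
  have [|_ ->//] := exits_at_uniq xd _ xy xy'.
  by apply: contra yU => /submx_trans; apply; apply: addsmxSl.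
by exists (Ordinal dn); apply/existsP; exists (x *m X ^+ d); rewrite yU.
Qed.

(** The exit point [y = a + b], with [a] in [U] and [b] in [G], does not depend on [g]. For nonzero
    [g] in [G] it lies in [U + g] exactly when [g] is a multiple of [b]; together with [g = 0] this
    excludes the [q] multiples of [b]. *)
Lemma card_exits_off U G X x : observable U X -> x != 0 ->
  (U :&: G = 0)%MS -> (U + G :=: 1%:M)%MS ->
  (\sum_(g : 'rV[F]_n | (g <= G)%MS && (g != 0)%R) exits_off U X x g = q ^ \rank G - q)%N.
Proof.
move=> obs x0 UG0 UG1.
have [d [y [_ yU yE]]] : exists d y, [/\ exits_at U X x d y, ~~ (y <= U)%MS
                & forall g, exits_off U X x g = ~~ (y <= U + g)%MS].
  have [d [y [xy yU _]]] := exits_off_first 0 obs x0.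
  exists d, y; split=> // g; have [d' [y' [xy' yU' ->]]] := exits_off_first g obs x0.
  by have [_ ->] := exits_at_uniq yU' yU xy' xy.
have /sub_addsmxP[[a0 b0] /= yab] : (y <= U + G)%MS by rewrite UG1 submx1.
set a := a0 *m U in yab; set b := b0 *m G in yab.
have aU : (a <= U)%MS by apply: submxMl. have bG : (b <= G)%MS by apply: submxMl.
have bn0 : b != 0 by apply: contra yU => /eqP b0E; rewrite yab b0E addr0.
have sumE : (\sum_(g : 'rV[F]_n | (g <= G)%MS && (g != 0)%R) exits_off U X x g =
     #|[set g : 'rV_n | (g <= G)%MS] :\: [set (c *: b)%R | c : F]|)%N.
  rewrite -sum1_card [RHS](bigID (fun g : 'rV_n => g != 0)) /= [X in (_ + X)%N]big1 ?addn0.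
    rewrite big_mkcond [RHS]big_mkcond; apply: eq_bigr => g _; rewrite !inE.
    case gG: (g <= G)%MS; case g0: (g != 0); rewrite ?andbF ?andbT //=.
    rewrite yE; have -> : (y <= U + g)%MS = (g \in [set c *: b | c : F]); last by case: ifP.
    apply/idP/imsetP => [/sub_addsmxP[[a1 c1] /= yE1]|[c _ gE]].
      have : (b - c1 *m g <= U :&: G)%MS.
        rewrite sub_capmx; apply/andP; split; last by rewrite addmx_sub ?eqmx_opp ?mulmx_sub.
        have -> : b - c1 *m g = a1 *m U - a.
          by apply/eqP; rewrite subr_eq addrAC eq_sym subr_eq -yE1 yab addrC.
        by rewrite addmx_sub ?eqmx_opp ?submxMl.
      rewrite UG0 submx0 subr_eq0 [c1]mx11_scalar mul_scalar_mx => /eqP bE.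
      exists (c1 0 0)^-1 => //; rewrite bE scalerA mulVf ?scale1r //.
      by apply: contraNneq bn0 => c0; rewrite bE c0 scale0r.
    rewrite yab addmx_sub ?(submx_trans aU) ?addsmxSl //.
    have c0 : c != 0 by apply: contraTneq g0 => c0; rewrite gE c0 scale0r eqxx.
    apply: submx_trans (addsmxSr _ _).
    by rewrite -[b](scalerK c0) -gE scalemx_sub.
  move=> g /andP[]; rewrite !inE => /andP[nin _] /negPn/eqP g0.
  by case/imsetP: nin; exists 0; rewrite // scale0r.
rewrite sumE cardsD card_row_space; congr (_ - _)%N.
rewrite (setIidPr _); last first.
  by apply/subsetP => g /imsetP[c _ ->]; rewrite inE scalemx_sub.
rewrite card_imset // => c1 c2 /eqP; rewrite -subr_eq0 -scalerBl scaler_eq0 (negPf bn0) orbF.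
by rewrite subr_eq0 => /eqP.
Qed.

End LateExit.

(** * Eigenvectors when the fixed spaces of both factors are given *)

Lemma card_translate (V : finZmodType) (S : {set V}) (a : V) :
  #|[set y | a + y \in S]| = #|S|.
Proof.
rewrite -[LHS](card_imset _ (addrI a)); apply: eq_card => x.
apply/imsetP/idP => [[y]|xS]; first by rewrite inE => yS ->.
by exists (x - a); rewrite ?inE /= addrCA subrr addr0.
Qed.

Lemma card_set_sum (T : finType) (S : {set T}) (P : pred T) :
  #|[set x in S | P x]| = (\sum_(x in S) P x)%N.
Proof.
rewrite -sum1_card; under eq_bigl do rewrite inE.
by rewrite big_mkcondr; apply: eq_bigr => x _; case: (P x).
Qed.

Section FixedDecomposition.

Variables (F : finFieldType) (N : nat).
Local Notation n := N.+1.
Local Notation q := #|F|.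
Local Notation GL := {'GL_N.+1[F]}.
Local Notation mx g := (@mx_of F N g).
Implicit Types (X : 'M[F]_n) (x y z u g : 'rV[F]_n).

Variables (c : GL) (U G : 'M[F]_n).
Hypotheses (c_irr : irreducible_mx (mx c)).
Hypotheses (UG0 : (U :&: G = 0)%MS) (UG1 : (U + G :=: 1%:M)%MS).
Hypothesis rG : (1 < \rank G)%N.

Let rank_sum : (\rank U + \rank G)%N = n.
Proof. by rewrite -(mxrank_disjoint_sum UG0) UG1 mxrank1. Qed.

(** For [X = h], [c ^ k = g h], [U = ker (g - 1)] and nonzero [u] in [G], the vector [u *m c ^ k]
    belongs to this set exactly when [u (g - 1)] is an eigenvector of [g]. *)
Definition scaled_coset X u :=
  [set y : 'rV[F]_n | [exists a : F, (a != 0) && (y - a *: u <= U *m X)%MS]].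

Section FixedElement.

Variable h : GL.
Hypothesis hF : h \in fixing_observable U G.

Let H := mx h.

Let obsH : observable U H. Proof. by move: hF; rewrite inE => /andP[]. Qed.

Let fixH x : (x <= G)%MS -> x *m H = x.
Proof.
move=> xG; move: hF; rewrite inE => /andP[GH _].
apply/eqP; rewrite -subr_eq0.
by have := submx_trans xG GH; rewrite sub_kermx mulmxBr mulmx1.
Qed.

Let UG_uniq x : (x <= U)%MS -> (x <= G)%MS -> x = 0.
Proof.
move=> xU xG; apply/eqP; rewrite -submx0 -UG0 sub_capmx xU xG //.
Qed.

Let UHG_uniq x : (x <= U *m H)%MS -> (x <= G)%MS -> x = 0.
Proof.
case/submxP => D xD xG; apply: UG_uniq (xG).
have : (x - D *m U) *m H = 0 by rewrite mulmxBl (fixH xG) -mulmxA -xD subrr.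
move/(congr1 (mulmx^~ (invmx H))); rewrite mulmxK ?mx_of_unit // mul0mx.
by move/eqP; rewrite subr_eq0 => /eqP ->; rewrite submxMl.
Qed.

Section FixedVector.

Variable u : 'rV[F]_n.
Hypotheses (uG : (u <= G)%MS) (u0 : u != 0).

Let S := scaled_coset H u.

Let uU : ~~ (u <= U)%MS.
Proof. by apply: contra u0 => uU; rewrite (UG_uniq uU uG). Qed.

Lemma scaled_coset_inv x a : (a <= U)%MS -> (x + a *m H \in S) = (x \in S).
Proof.
move=> aU; rewrite !inE; apply: eq_existsb => b; congr (_ && _).
have aH : (a *m H <= U *m H)%MS by apply: submxMr.
rewrite addrAC; apply/idP/idP => [|xb]; last by rewrite addmx_sub.
by move=> xb; rewrite -[x - _](addrK (a *m H)) addmx_sub // eqmx_opp.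
Qed.

Lemma scaled_coset_neq0 : 0 \notin S.
Proof.
rewrite inE; apply/existsP => -[a /andP[a0]]; rewrite sub0r eqmx_opp => auH.
have /eqP := UHG_uniq auH (scalemx_sub a uG).
by rewrite scaler_eq0 (negPf a0) (negPf u0).
Qed.

Lemma sum_scaled_coset (f : 'rV[F]_n -> nat) :
  (\sum_(x in S) f x =
   \sum_(a : F | a != 0%R) \sum_(z : 'rV[F]_n | (z <= U)%MS) f (z *m H + a *: u)%R)%N.
Proof.
pose P := [set p : F * 'rV[F]_n | (p.1 != 0) && (p.2 <= U)%MS].
pose g (p : F * 'rV[F]_n) : 'rV[F]_n := p.2 *m H + p.1 *: u.
have -> : S = g @: P.
  apply/setP => x; rewrite inE; apply/existsP/imsetP => [[a /andP[a0]]|[[a z]]].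
    case/submxP => D xE; exists (a, D *m U); rewrite ?inE /= ?a0 ?submxMl //.
    by rewrite /g /= -mulmxA -xE subrK.
  rewrite inE /= => /andP[a0 zU] ->; exists a.
  by rewrite a0 /g /= addrK submxMr.
rewrite big_imset /=; last first.
  move=> [a z] [b w]; rewrite !inE /= => /andP[_ zU] /andP[_ wU] /eqP.
  rewrite /g /= -subr_eq0 opprD addrACA -mulmxBl -scalerBl => /eqP/(canRL (addrK _)).
  rewrite sub0r => zw.
  have zwE : (z - w) *m H = 0.
    apply: UHG_uniq; first by rewrite submxMr // addmx_sub // eqmx_opp.
    by rewrite zw eqmx_opp scalemx_sub.
  move: zw; rewrite zwE => /esym/eqP; rewrite oppr_eq0 scaler_eq0 (negPf u0) orbF.
  rewrite subr_eq0 => /eqP ->; congr (_, _).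
  move/(congr1 (mulmx^~ (invmx H))): zwE; rewrite mulmxK ?mx_of_unit // mul0mx.
  by move/eqP; rewrite subr_eq0 => /eqP.
rewrite pair_big_dep /=; apply: eq_bigl => -[a z]; by rewrite inE.
Qed.

(** All observable extensions have equally many completions, so it remains to count those that send
    [u] into [S]: they are [#|S|] less the unobservable ones. The latter match the [x] in [S] that
    lie in some hull, that is, whose orbit first leaves [U] inside [U + u]. *)
Lemma card_completions_coset :
  #|[set k in completions c U H | u *m mx (c ^ k)%g \in S]| =
  (#|shift_completions c| * \prod_((\rank U).+2 <= i < n) (q ^ n - q ^ i) *
   \sum_(x in S) exits_off U H x u)%N.
Proof.
have [phi [Uphi uphi]] := separating_functional uU.
rewrite (card_completions_in c H S Uphi uphi).
rewrite (bigID (fun y => observable (U + u)%MS (H + phi *m y))) /=.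
have rU' := rank_extend Uphi uphi.
have rU'n : (\rank (U + u)%MS < n)%N by rewrite rU'; lia.
rewrite [X in (_ + X)%N]big1 ?addn0 => [|y /andP[_ /negP nobs]]; last first.
  apply: eq_card0 => k; apply/negP => /(completion_observable c_irr) Hk.
  exact/nobs/Hk.
rewrite (eq_bigr (fun=> (#|shift_completions c| *
    \prod_((\rank U).+2 <= i < n) (q ^ n - q ^ i))%N)) => [|y /andP[_ oy]];
  last by rewrite card_completions // rU'.
pose O := [set y | (u *m H + y \in S) && observable (U + u)%MS (H + phi *m y)].
rewrite (eq_bigl (fun y => y \in O)); last by move=> y; rewrite [RHS]inE.
rewrite sum_nat_const mulnC; congr (_ * _)%N.
have cS := card_translate S (u *m H).
have bad := card_unobservable_in Uphi uphi obsH scaled_coset_inv scaled_coset_neq0.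
have split_S : #|S| =
    (#|[set x in S | [exists w in slice phi (U + u)%MS, x <= inv_hull U H u w]%MS]| +
     \sum_(x in S) exits_off U H x u)%N.
  rewrite card_set_sum -big_split -[LHS]sum1_card /=; apply: eq_bigr => x xS.
  have x0 : x != 0 by apply: contraNneq scaled_coset_neq0 => xE; rewrite -xE.
  have [d [y [xy yU ->]]] := exits_off_first u obsH x0.
  have [Hxy yE] := exits_atP _ _ _ _ _ xy.
  suff -> : [exists w in slice phi (U + u)%MS, (x <= inv_hull U H u w)%MS] =
      (y <= U + u)%MS by case: (y <= _)%MS.
  apply/exists_inP/idP => [[w wU xw]|yUu].
    have := hull_orbit Uphi uphi wU xw Hxy; rewrite yE => yw.
    move: wU; rewrite inE => /andP[wU /eqP ew].
    by have /and3P[_ wU' _] := partial_inv_hull H Uphi uphi wU ew; apply: submx_trans yw wU'.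
  have ey : (x *m H ^+ d *m phi) 0 0 != 0.
    rewrite yE; apply: contra yU => /eqP ey.
    case/sub_addsmxP: yUu ey => -[a b] /= ->; rewrite mulmxDl -!mulmxA Uphi uphi.
    rewrite mulmx0 add0r mulmx1 => b0; rewrite [b]mx11_scalar b0 raddf0 mul0mx addr0.
    exact: submxMl.
  exists (((x *m H ^+ d *m phi) 0 0)^-1 *: (x *m H ^+ d)).
    by rewrite inE yE scalemx_sub //= -scalemxAl mxE -yE mulVf.
  by apply: orbit_hull => //; rewrite yE.
apply/eqP; rewrite -(eqn_add2l #|[set x in S |
  [exists w in slice phi (U + u)%MS, x <= inv_hull U H u w]%MS]|) -split_S -bad -cS.
rewrite -[X in _ == X]sum1_card (bigID (fun y => observable (U + u)%MS (H + phi *m y))) /=.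
rewrite addnC -!sum1_card; apply/eqP; congr (_ + _)%N; apply: eq_bigl => y; rewrite !inE //.
Qed.

End FixedVector.

Definition eigen_count (k : GL) :=
  #|[set u : 'rV[F]_n | [&& u <= G, u != 0 & u *m mx (c ^ k)%g \in scaled_coset H u]%MS]|.

(** Writing the elements of the coset as [z h + a u], the summand depends on [a] and [u] only
    through [g = a u], since [exits_off] does not see a scaling of its last argument. The choice of
    [a] leaves the factor [q - 1]. *)
Lemma sum_eigen_count :
  (\sum_(k in completions c U H) eigen_count k =
   #|shift_completions c| * \prod_((\rank U).+2 <= i < n) (q ^ n - q ^ i) *
   ((q - 1) * \sum_(g : 'rV[F]_n | (g <= G)%MS && (g != 0)%R)
       \sum_(z : 'rV[F]_n | (z <= U)%MS) exits_off U H (z *m H + g)%R g))%N.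
Proof.
pose T u (k : GL) := u *m mx (c ^ k)%g \in scaled_coset H u.
transitivity (\sum_(u : 'rV[F]_n | (u <= G)%MS && (u != 0)%R)
   #|[set k in completions c U H | T u k]|)%N.
  have cE k : eigen_count k = (\sum_(u : 'rV[F]_n | (u <= G)%MS && (u != 0)%R) T u k)%N.
    rewrite /eigen_count -sum1_card; under eq_bigl do rewrite inE andbA.
    by rewrite big_mkcondr; apply: eq_bigr => u _; rewrite /T; case: ifP.
  under eq_bigr do rewrite cE.
  rewrite exchange_big; apply: eq_bigr => u _; rewrite -sum1_card.
  under [RHS]eq_bigl do rewrite inE.
  by rewrite [RHS]big_mkcondr; apply: eq_bigr => k _; case: ifP.
rewrite (eq_bigr (fun u => #|shift_completions c| *
   \prod_((\rank U).+2 <= i < n) (q ^ n - q ^ i) *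
   (\sum_(a : F | a != 0%R) \sum_(z : 'rV[F]_n | (z <= U)%MS)
       exits_off U H (z *m H + a *: u)%R (a *: u)))%N); last first.
  move=> u /andP[uG u0]; rewrite card_completions_coset //; congr (_ * _)%N.
  rewrite sum_scaled_coset //; apply: eq_bigr => a a0; apply: eq_bigr => z _.
  by rewrite exits_offZ.
rewrite -big_distrr /=; congr (_ * _)%N; rewrite exchange_big /=.
rewrite (eq_bigr (fun=> (\sum_(g : 'rV[F]_n | (g <= G)%MS && (g != 0)%R)
       \sum_(z : 'rV[F]_n | (z <= U)%MS) exits_off U H (z *m H + g)%R g)%N)).
  rewrite (eq_bigl (fun a => a \in predC1 (0 : F))) // sum_nat_const cardC1.
  by rewrite subn1.
move=> a a0; rewrite [RHS](reindex_onto ( *:%R a) ( *:%R a^-1)) /=; last first.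
  by move=> g _; rewrite scalerA mulfV // scale1r.
apply: eq_bigl => u; rewrite scalerA mulVf // scale1r eqxx andbT.
by rewrite eqmx_scale // scaler_eq0 (negPf a0).
Qed.

End FixedElement.

(** After the swap from [z h + g] to [z h], each nonzero [z] in [U] contributes [q^(rank G) - q]
    vectors [g], for every [h]. The product of this number with [q^(rank U)] is
    [q^n - q^(rank U + 1)], the number of observable extensions, which also occurs on the right. *)
Lemma eigen_average (Phi : GL -> nat) : (forall h k, Phi (h ^ k)%g = Phi h) ->
  (q ^ \rank U * \sum_(h in fixing_observable U G)
      Phi h * \sum_(k in completions c U (mx h)) eigen_count h k =
   (q - 1) * (q ^ \rank U - 1) * \sum_(h in fixing_observable U G)
      Phi h * #|completions c U (mx h)|)%N.
Proof.
move=> PhiJ; pose w := (#|shift_completions c| * \prod_((\rank U).+2 <= i < n) (q ^ n - q ^ i))%N.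
pose Phi_sum := (\sum_(h in fixing_observable U G) Phi h)%N.
have q_gt1 : (1 < q)%N := card_finNzRing_gt1 F.
have comp_sum : (\sum_(h in fixing_observable U G) Phi h * #|completions c U (mx h)| =
    (q ^ n - q ^ (\rank U).+1) * w * Phi_sum)%N.
  rewrite mulnC /Phi_sum big_distrl /=; apply: eq_bigr => h hF; congr (_ * _)%N.
  rewrite card_completions //; last by lia.
    by rewrite big_ltn 1?mulnCA //; lia.
  by move: hF; rewrite inE => /andP[].
have exit_sum : (\sum_(h in fixing_observable U G) Phi h *
     \sum_(g : 'rV[F]_n | (g <= G)%MS && (g != 0)%R)
       \sum_(z : 'rV[F]_n | (z <= U)%MS) exits_off U (mx h) (z *m mx h + g)%R g =
    (q ^ \rank U - 1) * (q ^ \rank G - q) * Phi_sum)%N.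
  under eq_bigr => h _ do rewrite big_distrr /=.
  rewrite exchange_big /=.
  transitivity (\sum_(g : 'rV[F]_n | (g <= G)%MS && (g != 0)%R)
       \sum_(z : 'rV[F]_n | (z <= U)%MS) \sum_(h in fixing_observable U G)
         Phi h * exits_off U (mx h) (z *m mx h) g)%N.
    apply: eq_bigr => g /andP[gG _]; under eq_bigr => h _ do rewrite big_distrr /=.
    by rewrite exchange_big; apply: eq_bigr => z zU; rewrite (sum_exits_off_swap PhiJ zU gG).
  (* The orbit of [z = 0] never leaves [U], so this [z] contributes nothing. *)
  rewrite exchange_big /= (bigD1 0) ?sub0mx //= big1 ?add0n; last first.
    move=> g _; apply: big1 => h _; rewrite mul0mx.
    suff -> : exits_off U (mx h) 0 g = false by rewrite muln0.
    rewrite /exits_off; apply/existsP => -[d /existsP[y] /andP[yUg /exits_atP[_ yE]]].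
    by move: yUg; rewrite -yE mul0mx sub0mx.
  rewrite (eq_bigr (fun=> ((q ^ \rank G - q) * Phi_sum)%N)).
    rewrite (eq_bigl (fun z : 'rV[F]_n => z \in [set z | (z <= U)%MS] :\ 0)); last first.
      by move=> z; rewrite !inE andbC.
    rewrite sum_nat_const mulnA; congr (_ * _ * _)%N.
    have := cardsD1 0 [set z : 'rV[F]_n | (z <= U)%MS].
    by rewrite inE sub0mx card_row_space => ->; rewrite addKn.
  move=> z /andP[zU z0]; rewrite exchange_big /Phi_sum big_distrr /=.
  apply: eq_bigr => h; rewrite inE => /andP[_ obs].
  rewrite -big_distrr /= card_exits_off //; first by rewrite mulnC.
  by apply: contra z0 => /eqP/(congr1 (mulmx^~ (invmx (mx h))));
    rewrite mulmxK ?mx_of_unit // mul0mx => ->.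
under eq_bigr => h hF do rewrite sum_eigen_count // mulnCA [(Phi h * _)%N]mulnCA.
rewrite -big_distrr /= -big_distrr /= exit_sum comp_sum -/w [(q ^ (\rank U).+1)%N]expnS.
have -> : (q ^ n = q ^ \rank U * q ^ \rank G)%N by rewrite -expnD rank_sum.
have : (q * q ^ \rank U <= q ^ \rank U * q ^ \rank G)%N.
  by rewrite mulnC leq_mul // -{1}[q]expn1 leq_exp2l // ltnW.
move: (q ^ \rank U)%N (q ^ \rank G)%N => qU qG le.
have -> : (qU * qG - q * qU = qU * (qG - q))%N by rewrite mulnBr [(q * _)%N]mulnC.
ring.
Qed.

End FixedDecomposition.

(** * Averaging over the conjugates of [c] and over all pairs of fixed spaces *)

Section EigenSum.

Variables (F : finFieldType) (N : nat).
Local Notation n := N.+1.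
Local Notation q := #|F|.
Local Notation GL := {'GL_N.+1[F]}.
Local Notation mx g := (@mx_of F N g).
Implicit Types (X : 'M[F]_n) (x y z u : 'rV[F]_n) (g h k c : GL).

Definition mov g := mx g - 1%:M.

Definition codim_fix g := \rank (mov g).

Definition moved_eigen g := [set v : 'rV[F]_n | [&& v <= mov g, v != 0 & v *m mx g <= v]%MS].

Lemma movJ g k : mov (g ^ k)%g = invmx (mx k) *m mov g *m mx k.
Proof.
rewrite /mov conjgE !mx_ofM mx_ofV mulmxBr mulmx1 mulmxBl mulVmx ?mx_of_unit //.
by rewrite !mulmxA.
Qed.

Lemma codim_fixJ g k : codim_fix (g ^ k)%g = codim_fix g.
Proof.
rewrite /codim_fix movJ mxrankMfree ?row_free_unit ?mx_of_unit //.
by rewrite (eqmxMfull _ _) // row_full_unit unitmx_inv mx_of_unit.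
Qed.

Lemma card_moved_eigenJ g k : #|moved_eigen (g ^ k)%g| = #|moved_eigen g|.
Proof.
have inj : injective (fun v : 'rV[F]_n => v *m mx k).
  by apply: row_free_inj; rewrite row_free_unit mx_of_unit.
rewrite -[RHS](card_imset _ inj); apply: eq_card => v.
have memE w : (w *m mx k \in moved_eigen (g ^ k)%g) = (w \in moved_eigen g).
  rewrite !inE movJ; congr [&& _, _ & _].
  - rewrite submxMfree ?row_free_unit ?mx_of_unit //.
    by rewrite (eqmxMfull _ _) // row_full_unit unitmx_inv mx_of_unit.
  - by rewrite -[w == 0](inj_eq inj) mul0mx.
  rewrite conjgE !mx_ofM mx_ofV !mulmxA mulmxK ?mx_of_unit //.
  by rewrite submxMfree ?row_free_unit ?mx_of_unit.
apply/idP/imsetP => [vM|[w wM ->]]; last by rewrite memE.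
exists (v *m invmx (mx k)); last by rewrite mulmxKV ?mx_of_unit.
by rewrite -memE mulmxKV ?mx_of_unit.
Qed.

Variable c : GL.
Hypotheses (c_irr : irreducible_mx (mx c)) (c_fix : codim_fix c = n).

Let fix0 k m (Z : 'M[F]_(m, n)) : Z *m mx (c ^ k)%g = Z -> Z = 0.
Proof.
move=> Zc; have : Z *m mov (c ^ k)%g = 0 by rewrite mulmxBr Zc mulmx1 subrr.
move/(congr1 (mulmx^~ (invmx (mov (c ^ k)%g)))); rewrite mulmxK ?mul0mx //.
by rewrite -row_full_unit /row_full -/(codim_fix _) codim_fixJ c_fix.
Qed.

Section Ranks.

Variables (s r : nat).
Hypotheses (sr : (s + r = n)%N) (r_gt1 : (1 < r)%N).

Let good d h := (codim_fix h == s) && (codim_fix (d * h^-1)%g == r).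

(** The first two conditions select the canonical matrix of each row space, so that every pair of
    subspaces occurs once. *)
Let valid (p : 'M[F]_n * 'M[F]_n) :=
  [&& (<<p.1>> == p.1 :> 'M_n)%MS, (<<p.2>> == p.2 :> 'M_n)%MS, \rank p.1 == s,
      \rank p.2 == r & (p.1 :&: p.2 == 0 :> 'M_n)%MS].

(* Factorizations [d = g h] with [rank (g - 1) + rank (h - 1) = n], sorted by the
   fixed spaces [p = (U, G)] of [g] and [h]. *)
Lemma good_fixed_spaces d k h p : d = (c ^ k)%g ->
  (good d h && ((<<kermx (mov (d * h^-1)%g)>>%MS, <<kermx (mov h)>>%MS) == p)) =
  [&& valid p, h \in fixing_observable p.1 p.2 & k \in completions c p.1 (mx h)].
Proof.
move=> dE; case: p => U G /=; rewrite xpair_eqE.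
have dgh : mx d = mx (d * h^-1)%g *m mx h by rewrite -mx_ofM mulgKV.
have [g gE] : exists g, g = (d * h^-1)%g by exists (d * h^-1)%g.
rewrite /good -gE in dgh *.
have ker_fix m (Z : 'M_(m, n)) f : (Z <= kermx (mov f))%MS = (Z *m mx f == Z).
  by rewrite sub_kermx mulmxBr mulmx1 subr_eq0.
apply/idP/idP => [/and3P[/andP[/eqP hs /eqP gr] /eqP UE /eqP GE]|].
  have rU : \rank U = s.
    by rewrite -UE mxrank_gen mxrank_ker -/(codim_fix _) gr -sr addnK.
  have rG : \rank G = r.
    by rewrite -GE mxrank_gen mxrank_ker -/(codim_fix _) hs -sr addKn.
  have Ug : U *m mx g = U.
    by apply/eqP; rewrite -ker_fix -UE genmxE.
  have Gh : G *m mx h = G by apply/eqP; rewrite -ker_fix -GE genmxE.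
  have kU : k \in completions c U (mx h).
    by rewrite inE sub_kermx mulmxBr -dE dgh mulmxA Ug subrr.
  rewrite /valid /= -{1}UE genmx_id UE eqxx -{1}GE genmx_id GE eqxx rU rG !eqxx kU andbT /=.
  apply/andP; split; last first.
    rewrite inE -/(mov h) ker_fix Gh eqxx /=.
    by apply: completion_observable kU => //; rewrite rU -sr; lia.
  (* [g h] fixes [U :&: G] pointwise, while a conjugate of [c] has no nonzero fixed vector. *)
  apply/eqP; apply: (@fix0 k); rewrite -dE dgh mulmxA.
  have /submxP[D1 E1] := capmxSl U G; have /submxP[D2 E2] := capmxSr U G.
  have -> : (U :&: G)%MS *m mx g = (U :&: G)%MS by rewrite E1 -mulmxA Ug.
  by rewrite E2 -mulmxA Gh.
rewrite /valid /= inE -/(mov h) ker_fix inE sub_kermx mulmxBr subr_eq0 -dE.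
move=> /and3P[/and5P[/eqP UU /eqP GG /eqP rU /eqP rG /eqP UG0] /andP[/eqP Gh obs] /eqP Ud].
have UG1 : (U + G :=: 1%:M)%MS.
  apply/eqmxP; rewrite submx1 sub1mx /row_full.
  by rewrite (mxrank_disjoint_sum UG0) rU rG sr eqxx.
have Ug : U *m mx g = U.
  by rewrite gE mx_ofM mx_ofV mulmxA Ud mulmxK ?mx_of_unit.
have dec x : exists a b, [/\ x = a + b, (a <= U)%MS & (b <= G)%MS].
  have /sub_addsmxP[[a b] /= xE] : (x <= U + G)%MS by rewrite UG1 submx1.
  by exists (a *m U), (b *m G); rewrite !submxMl.
(* If [h] fixes [a + b], it fixes [a]; on [U] it agrees with [d], so [a] is fixed by [d] and
   vanishes. *)
have kh : (kermx (mov h) :=: G)%MS.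
  apply/eqmxP; rewrite ker_fix Gh eqxx andbT; apply/rV_subP => x.
  have [a [b [-> aU bG]]] := dec x.
  rewrite ker_fix mulmxDl; have -> : b *m mx h = b.
    by case/submxP: bG => D ->; rewrite -mulmxA Gh.
  move=> /eqP/addIr ah; rewrite (@fix0 k _ a) ?add0r // -dE.
  by case/submxP: aU ah => D -> ah; rewrite -mulmxA Ud mulmxA.
have kg : (kermx (mov g) :=: U)%MS.
  apply/eqmxP; rewrite ker_fix Ug eqxx andbT; apply/rV_subP => x.
  have [a [b [-> aU bG]]] := dec x.
  rewrite ker_fix mulmxDl; have -> : a *m mx g = a.
    by case/submxP: aU => D ->; rewrite -mulmxA Ug.
  move=> /eqP/addrI bg; rewrite (@fix0 k _ b) ?addr0 // -dE dgh mulmxA bg.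
  by case/submxP: bG => D ->; rewrite -mulmxA Gh.
rewrite (eq_genmx kg) (eq_genmx kh) UU GG !eqxx andbT.
have := mxrank_ker (mov h); rewrite kh rG -/(codim_fix _) => rh.
have := mxrank_ker (mov g); rewrite kg rU -/(codim_fix _) => rg.
have lh : (codim_fix h <= n)%N by apply: rank_leq_col.
have lg : (codim_fix g <= n)%N by apply: rank_leq_col.
by apply/andP; split; apply/eqP; lia.
Qed.

(** As [G] is a complement of [U = ker (g - 1)], the map [u |-> u (g - 1)] is a bijection from [G]
    onto the image of [g - 1]. *)
Lemma eigen_countE U G h k : valid (U, G) -> h \in fixing_observable U G ->
  k \in completions c U (mx h) ->
  eigen_count c U G h k = #|moved_eigen (c ^ k * h^-1)%g|.
Proof.
move=> vUG hF kU.
have := @good_fixed_spaces (c ^ k)%g k h (U, G) erefl.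
rewrite vUG hF kU => /andP[_]; rewrite xpair_eqE => /andP[/eqP UE _].
have dgh : mx (c ^ k)%g = mx (c ^ k * h^-1)%g *m mx h by rewrite -mx_ofM mulgKV.
move: (c ^ k * h^-1)%g dgh UE => g dgh UE.
have kg x : (x *m mov g == 0) = (x <= U)%MS by rewrite -UE genmxE sub_kermx.
have UG0 x : (x <= U)%MS -> (x <= G)%MS -> x = 0.
  move=> xU xG; apply/eqP; rewrite -submx0.
  by case/and5P: vUG => _ _ _ _ /eqP /= <-; rewrite sub_capmx xU.
have Gh x : (x <= G)%MS -> x *m mx h = x.
  move=> xG; move: hF; rewrite inE => /andP[GH _]; apply/eqP; rewrite -subr_eq0.
  by have := submx_trans xG GH; rewrite sub_kermx mulmxBr mulmx1.
have comm : mx g *m mov g = mov g *m mx g.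
  by rewrite mulmxBr mulmxBl mulmx1 mul1mx.
have cosetE u : (u <= G)%MS -> u != 0 ->
    (u *m mx (c ^ k)%g \in scaled_coset U (mx h) u) = (u *m mov g *m mx g <= u *m mov g)%MS.
  move=> uG u0; have stepE a : u *m mx (c ^ k)%g - a *: u = (u *m mx g - a *: u) *m mx h.
    by rewrite mulmxBl -scalemxAl (Gh u uG) dgh mulmxA.
  have subE a : (u *m mx (c ^ k)%g - a *: u <= U *m mx h)%MS =
      (u *m mov g *m mx g == a *: (u *m mov g)).
    rewrite stepE submxMfree ?row_free_unit ?mx_of_unit // -kg mulmxBl -!mulmxA comm.
    by rewrite -scalemxAl subr_eq0.
  rewrite inE; apply/existsP/sub_rVP => [[a /andP[a0]]|[a aE]].
    by rewrite subE => /eqP; exists a.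
  exists a; rewrite subE aE eqxx andbT; apply: contra u0 => /eqP a0.
  apply/eqP/(UG0 _ _ uG); rewrite -kg.
  move: aE; rewrite a0 scale0r => /(congr1 (mulmx^~ (invmx (mx g)))).
  by rewrite mulmxK ?mx_of_unit // mul0mx => ->.
rewrite /eigen_count -(card_in_imset (f := fun u : 'rV[F]_n => u *m mov g)).
  apply: eq_card => v; apply/imsetP/idP => [[u]|].
    rewrite in_set => /and3P[uG u0]; rewrite cosetE // => uS ->.
    by rewrite inE submxMl uS andbT /=; apply: contra u0; rewrite kg => /UG0 ->.
  rewrite inE => /and3P[/submxP[w vE] v0 vg].
  have UG1 : (U + G :=: 1%:M)%MS.
    case/and5P: vUG => _ _ /eqP /= rU /eqP /= rG /eqP UG00.
    apply/eqmxP; rewrite submx1 sub1mx /row_full.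
    by rewrite (mxrank_disjoint_sum UG00) rU rG sr eqxx.
  have /sub_addsmxP[[a b] /= wE] : (w <= U + G)%MS by rewrite UG1 submx1.
  have vb : v = b *m G *m mov g.
    rewrite vE wE mulmxDl; have /eqP -> : a *m U *m mov g == 0 by rewrite kg submxMl.
    by rewrite add0r.
  have b0 : b *m G != 0 by apply: contra v0 => /eqP b0; rewrite vb b0 mul0mx.
  exists (b *m G) => //; rewrite in_set submxMl b0 /=.
  by rewrite cosetE ?submxMl // -vb.
move=> x y; rewrite !inE => /and3P[xG _ _] /and3P[yG _ _] /eqP.
rewrite -subr_eq0 -mulmxBl kg => xyU.
apply/eqP; rewrite -subr_eq0; apply/eqP/UG0 => //.
by rewrite addmx_sub // eqmx_opp.
Qed.

(** Both sums are unchanged when [c] is replaced by a conjugate, so they may be summed over all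
    [c ^ k]. Regrouped by the pair of fixed spaces, the identity holds for each pair separately by
    [eigen_average], since [rank U = s] throughout. *)
Lemma sum_moved_eigen (Phi : GL -> nat) : (forall h k, Phi (h ^ k)%g = Phi h) ->
  (q ^ s * \sum_(h | good c h) Phi h * #|moved_eigen (c * h^-1)%g| =
   (q - 1) * (q ^ s - 1) * \sum_(h | good c h) Phi h)%N.
Proof.
move=> PhiJ.
have avg (f : GL -> GL -> nat) : (forall d h k, f (d ^ k)%g (h ^ k)%g = f d h) ->
    (#|[set: GL]| * \sum_(h | good c h) f c h =
     \sum_(p | valid p) \sum_(h in fixing_observable p.1 p.2)
        \sum_(k in completions c p.1 (mx h)) f (c ^ k)%g h)%N.
  move=> fJ.
  transitivity (\sum_(k : GL) \sum_(h | good (c ^ k)%g h) f (c ^ k)%g h)%N.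
    rewrite cardsT -sum_nat_const; apply: eq_bigr => k _.
    rewrite [RHS](reindex_inj (conjg_inj k)) /=.
    apply: eq_big => h; last by rewrite fJ.
    by rewrite /good -conjVg -conjMg !codim_fixJ.
  rewrite (exchange_big_dep predT) //= pair_big_dep /=.
  rewrite (partition_big (fun p : GL * GL =>
     (<<kermx (mov ((c ^ p.2) * p.1^-1)%g)>>%MS, <<kermx (mov p.1)>>%MS)) valid) /=.
    apply: eq_bigr => p vp; rewrite [RHS]pair_big_dep /=; apply: eq_bigl => -[h k] /=.
    by rewrite (good_fixed_spaces _ _ (erefl _)) vp.
  move=> [h k] /= hk.
  by have := good_fixed_spaces h (<<kermx (mov ((c ^ k) * h^-1)%g)>>%MS, <<kermx (mov h)>>%MS)
    (erefl (c ^ k)%g); rewrite hk eqxx => /esym/and3P[].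
have gt0 : (0 < #|[set: GL]|)%N by apply/card_gt0P; exists 1%g; rewrite inE.
have key := avg (fun d h => Phi h * #|moved_eigen (d * h^-1)%g|)%N.
apply/eqP; rewrite -(eqn_pmul2l gt0); apply/eqP.
rewrite mulnCA key => [|d h k]; last first.
  by rewrite -conjVg -conjMg PhiJ card_moved_eigenJ.
rewrite [RHS]mulnCA (avg (fun _ h => Phi h)) => [|d h k]; last exact: PhiJ.
rewrite !big_distrr /=; apply: eq_bigr => -[U G] vUG /=.
have /and5P[_ _ /eqP /= rU /eqP /= rG /eqP UG00] := vUG.
have UG1 : (U + G :=: 1%:M)%MS.
  apply/eqmxP; rewrite submx1 sub1mx /row_full.
  by rewrite (mxrank_disjoint_sum UG00) rU rG sr eqxx.
have := eigen_average c_irr UG00 UG1 _ PhiJ; rewrite rG rU => /(_ r_gt1) => avgE.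
transitivity (q ^ s * \sum_(h in fixing_observable U G)
      Phi h * \sum_(k in completions c U (mx h)) eigen_count c U G h k)%N.
  congr (_ * _)%N; apply: eq_bigr => h hF; rewrite big_distrr /=.
  by apply: eq_bigr => k kU; rewrite eigen_countE.
rewrite avgE; congr (_ * _)%N; apply: eq_bigr => h _.
by rewrite sum_nat_const mulnC.
Qed.

End Ranks.

End EigenSum.

(** * Splitting off a factor of rank one *)

Lemma card_linear_system (F : finFieldType) (k r : nat) (A : 'M[F]_(k, r)) (y : 'cV[F]_k) :
  row_free A -> #|[set a : 'cV[F]_r | A *m a == y]| = (#|F| ^ (r - k))%N.
Proof.
move=> Afree; have /row_freeP[B AB] := Afree; pose a0 := B *m y.
have Aa0 : A *m a0 = y by rewrite mulmxA AB mul1mx.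
have inj : injective (fun x : 'rV[F]_r => a0 + x^T).
  by move=> x z /addrI/(congr1 trmx); rewrite !trmxK.
transitivity #|[set x : 'rV[F]_r | (x <= kermx A^T)%MS]|.
  rewrite -[RHS](card_imset _ inj); apply: eq_card => a.
  rewrite inE; apply/eqP/imsetP => [Aa|[x]].
    exists (a - a0)^T; last by rewrite trmxK addrC subrK.
    by rewrite inE sub_kermx -trmx_mul mulmxBr Aa Aa0 subrr trmx0.
  rewrite inE sub_kermx => /eqP xA ->.
  by rewrite mulmxDr Aa0 -[A *m _]trmxK trmx_mul trmxK xA trmx0 addr0.
by rewrite card_row_space mxrank_ker mxrank_tr (eqP Afree).
Qed.

(** The invertibility criterion contained in the matrix determinant lemma. *)
Lemma unitmx_sub_rank1 (F : fieldType) (n : nat) (A : 'M[F]_n) (phi : 'cV[F]_n) (w : 'rV[F]_n) :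
  A \in unitmx ->
  (A - phi *m w \in unitmx) = (1%:M - w *m invmx A *m phi != 0).
Proof.
move=> Au; apply/idP/idP => [Eu|].
  apply: contraTneq Eu => /eqP; rewrite subr_eq0 => /eqP wE.
  apply/negP => Eu; have : w *m invmx A *m (A - phi *m w) = 0.
    by rewrite mulmxBr mulmxKV // mulmxA -wE mul1mx subrr.
  move/(congr1 (mulmx^~ (invmx (A - phi *m w)))); rewrite mulmxK // mul0mx => w0.
  move: wE; rewrite w0 mul0mx => /matrixP/(_ 0 0); rewrite !mxE => /eqP.
  by rewrite oner_eq0.
move=> nz; rewrite -row_free_unit -kermx_eq0; apply/eqP/row_matrixP => i; rewrite row0.
set x := row i _; have : x *m (A - phi *m w) = 0 by apply/sub_kermxP; exact: row_sub.
rewrite mulmxBr => /eqP; rewrite subr_eq0 => /eqP xA.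
have xE : x = x *m phi *m (w *m invmx A) by rewrite mulmxA -[x *m phi *m w]mulmxA -xA mulmxK.
have : x *m phi *m (1%:M - w *m invmx A *m phi) = 0.
  by rewrite mulmxBr mulmx1 mulmxA -xE subrr.
rewrite [x *m phi]mx11_scalar mul_scalar_mx => /eqP.
rewrite scaler_eq0 (negPf nz) orbF => /eqP xp.
by rewrite xE [x *m phi]mx11_scalar xp raddf0 mul0mx.
Qed.

Lemma rank_additive_sub (F : fieldType) (m n : nat) (E B : 'M[F]_(m, n)) :
  (\rank E + \rank (B - E)%R <= \rank B)%N -> (E <= B)%MS.
Proof.
move=> le; have Bsub : (B <= E + (B - E)%R)%MS.
  by rewrite -[X in (X <= _)%MS](subrK E) addrC addmx_sub_adds.
apply: submx_trans (addsmxSl E (B - E)) _.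
rewrite -(geq_leqif (mxrank_leqif_sup Bsub)); apply: leq_trans le.
by case: (mxrank_adds_leqif E (B - E)).
Qed.

(** Additivity of ranks puts the row space of [E] into that of [L *m R], and by transposition the
    column space too; the two inclusions combine to the two-sided factorization. *)
Lemma rank_additive_factor (F : fieldType) (m n r : nat) (E : 'M[F]_(m, n))
    (L : 'M[F]_(m, r)) (R : 'M[F]_(r, n)) :
  row_full L -> (\rank E + \rank (L *m R - E)%R <= \rank (L *m R))%N ->
  exists e, E = L *m e *m R.
Proof.
move=> /row_fullP[L' LL] le.
have /submxP[Y EY] : (E <= L *m R)%MS by apply: rank_additive_sub.
have : (E^T <= (L *m R)^T)%MS.
  by apply: rank_additive_sub; rewrite -linearB /= !mxrank_tr.
case/submxP => Z EZ; have EZ' : E = L *m (R *m Z^T).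
  by rewrite -[E]trmxK EZ !trmx_mul !trmxK mulmxA.
exists (L' *m Y *m L).
have : L' *m E = L' *m Y *m L *m R by rewrite {1}EY !mulmxA.
by rewrite {1}EZ' mulmxA LL mul1mx => RZ; rewrite -mulmxA -RZ.
Qed.

Lemma stable_invmx (F : fieldType) (m n : nat) (X : 'M[F]_n) (b : 'M[F]_(m, n)) :
  X \in unitmx -> (b *m X <= b)%MS -> (b *m invmx X <= b)%MS.
Proof.
move=> Xu bX; have : (b <= b *m X)%MS.
  by rewrite -(geq_leqif (mxrank_leqif_sup bX)) mxrankMfree ?row_free_unit.
by move/(submxMr (invmx X)); rewrite mulmxK.
Qed.

Section RankOneFactors.

Variables (F : finFieldType) (N : nat).
Local Notation n := N.+1.
Local Notation q := #|F|.
Local Notation GL := {'GL_N.+1[F]}.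
Local Notation mx g := (@mx_of F N g).

Variable g : GL.
Let B := mov g.
Let r := \rank B.
Hypothesis r_gt1 : (1 < r)%N.

Let L : 'M[F]_(n, r) := col_base B.
Let R : 'M[F]_(r, n) := row_base B.
(** The matrix of [g] on the image of [g - 1], in the basis given by the rows of [R]. *)
Let D : 'M[F]_r := 1%:M + R *m L.

Let LR : L *m R = B. Proof. exact: mulmx_base. Qed.
Let Rfree : row_free R. Proof. exact: row_base_free. Qed.
Let Lfull : row_full L. Proof. exact: col_base_full. Qed.

Let rank_LXR (X : 'M[F]_r) : \rank (L *m X *m R) = \rank X.
Proof. by rewrite mxrankMfree // (eqmxMfull _ Lfull). Qed.

Let RgE : R *m mx g = D *m R.
Proof.
have -> : mx g = 1%:M + B by rewrite /B /mov addrC subrK.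
by rewrite -LR mulmxDr mulmxDl mulmx1 mul1mx mulmxA.
Qed.

Let Du : D \in unitmx.
Proof.
rewrite -row_free_unit -kermx_eq0; apply/eqP/row_matrixP => i; rewrite row0.
set x := row i _; have xD : x *m D = 0 by apply/sub_kermxP; exact: row_sub.
have : x *m R *m mx g = 0 by rewrite -mulmxA RgE mulmxA xD mul0mx.
move/(congr1 (mulmx^~ (invmx (mx g)))); rewrite mulmxK ?mx_of_unit // mul0mx => xR.
by apply: (row_free_inj Rfree); rewrite xR mul0mx.
Qed.

Let RgL : R *m invmx (mx g) *m L = 1%:M - invmx D.
Proof.
have -> : R *m invmx (mx g) = invmx D *m R.
  apply: (can_inj (mulmxK (mx_of_unit g))).
  by rewrite /= mulmxKV ?mx_of_unit // -mulmxA RgE mulKmx.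
rewrite -mulmxA; have -> : R *m L = D - 1%:M by rewrite /D addrC addKr.
by rewrite mulmxBr mulVmx // mulmx1.
Qed.

Definition rank1_factors :=
  [set t : GL | (codim_fix t == 1) && (codim_fix (t^-1 * g)%g == r.-1)]%N.

Let pairs := [set p : 'cV[F]_r * 'rV[F]_r |
  (p.2 *m p.1 == 1%:M) && (p.2 *m invmx D *m p.1 != 0)].

Let prod_pair (p : 'cV[F]_r * 'rV[F]_r) := p.1 *m p.2.

Let diff t : 'M[F]_n := mx g - mx (t^-1 * g)%g.

Let diff_inj : injective diff.
Proof.
move=> t t' /subrI/mx_of_inj/mulIg/invg_inj //.
Qed.

Let rank_diff t : \rank (diff t) = codim_fix t.
Proof.
have -> : diff t = invmx (mx t) *m (mov t *m mx g).
  rewrite /diff /mov mulmxBl mul1mx mulmxBr mulKmx ?mx_of_unit //.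
rewrite (eqmxMfull _ _) ?row_full_unit ?unitmx_inv ?mx_of_unit //.
by rewrite mxrankMfree // row_free_unit mx_of_unit.
Qed.

Let mov_diff t : mov (t^-1 * g)%g = B - diff t.
Proof. by rewrite /diff /B /mov opprB [RHS]addrC addrA subrK. Qed.

(** The rank of [1 - e] gives a nonzero [x] with [x e = x]. For [e = a b] this makes [x] a multiple
    of [b], and [b a = 1] follows. *)
Let rank1_idem (e : 'M[F]_r) : (\rank e == 1%N) && (\rank (1%:M - e) == r.-1) =
  (e \in [set prod_pair p | p : 'cV[F]_r * 'rV[F]_r & p.2 *m p.1 == 1%:M]).
Proof.
apply/andP/imsetP => [[/eqP re /eqP r1e]|[[a b]]].
  have [a [b eE]] : exists a : 'cV[F]_r, exists b : 'rV[F]_r, e = a *m b.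
    by have := mulmx_base e; move: (col_base e) (row_base e); rewrite re => a b <-; exists a, b.
  exists (a, b); rewrite // inE /=.
  have : kermx (1%:M - e) != 0 by rewrite -mxrank_eq0 mxrank_ker r1e; lia.
  case/rowV0Pn => x /sub_kermxP xe x0.
  move: xe; rewrite mulmxBr mulmx1 eE mulmxA => /eqP; rewrite subr_eq0 => /eqP xE.
  move: xE; rewrite [x *m a]mx11_scalar mul_scalar_mx; set c := (x *m a) 0 0 => xE.
  have c0 : c != 0 by apply: contra x0 => /eqP c0; rewrite xE c0 scale0r.
  have : x *m a = c *: (b *m a) by rewrite {1}xE -scalemxAl.
  rewrite [x *m a]mx11_scalar -/c -scalemx1 => /(scalerI c0) <- //.
rewrite inE /= => /eqP ba ->; rewrite /prod_pair /=.
have b0 : b != 0 by apply: contra_eq_neq ba => ->; rewrite mul0mx eq_sym oner_neq0.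
have ab1 : \rank (a *m b) = 1%N.
  apply/eqP; rewrite eqn_leq (leq_trans (mxrankM_maxr _ _)) ?rank_leq_row //=.
  rewrite lt0n mxrank_eq0; apply: contra b0 => /eqP ab0.
  by rewrite -[b]mul1mx -ba -mulmxA ab0 mulmx0.
split; apply/eqP => //; apply/eqP; rewrite eqn_leq; apply/andP; split.
  have : (b <= kermx (1%:M - a *m b))%MS.
    by rewrite sub_kermx mulmxBr mulmx1 mulmxA ba mul1mx subrr.
  move/mxrankS; rewrite mxrank_ker rank_rV b0 /= subn_gt0.
  by rewrite -[X in (_ < X)%N](prednK (ltnW r_gt1)) ltnS.
have := mxrank_add (a *m b) (1%:M - a *m b).
by rewrite addrC subrK mxrank1 ab1 -subn1 leq_subLR.
Qed.

Let mov_diffE t : codim_fix (t^-1 * g)%g = \rank (B - diff t).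
Proof. by rewrite /codim_fix mov_diff. Qed.

Let unit_pair (a : 'cV[F]_r) (b : 'rV[F]_r) : b *m a = 1%:M ->
  (mx g - L *m (a *m b) *m R \in unitmx) = (b *m invmx D *m a != 0).
Proof.
move=> ba; rewrite -mulmxA -[a *m b *m R]mulmxA mulmxA.
rewrite unitmx_sub_rank1 ?mx_of_unit //; congr (_ != _).
rewrite mulmxA -[b *m R *m _ *m L]mulmxA -[b *m R *m _]mulmxA.
by rewrite [R *m (_ *m L)]mulmxA RgL mulmxBr mulmx1 mulmxBl ba subKr.
Qed.

(* With [g - 1 = L R], the factorizations [g = t h] have [h = g - L a b R] for an
   idempotent [a b] that determines [(a, b)] up to a scalar; the second condition
   in [pairs] says that [h] is invertible. *)
Lemma card_pairs_rank1 : #|pairs| = ((q - 1) * #|rank1_factors|)%N.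
Proof.
pose idem : {set 'M[F]_r} := prod_pair @: pairs.
have -> : #|rank1_factors| = #|idem|.
  have injLR : injective (fun e : 'M[F]_r => L *m e *m R).
    move=> e e' /(row_free_inj Rfree); have /row_fullP[L' LL] := Lfull.
    by move/(congr1 (mulmx L')); rewrite !(mulmxA L' L) LL !mul1mx.
  rewrite -(card_imset _ diff_inj) -(card_imset _ injLR); apply: eq_card => E.
  apply/imsetP/imsetP => [[t]|[e /imsetP[[a b]]]].
    rewrite inE => /andP[/eqP rt /eqP rtg] EE.
    have rE : \rank E = 1%N by rewrite EE rank_diff.
    have rBE : \rank (B - E) = r.-1 by rewrite EE -mov_diff.
    have [|e eE] := rank_additive_factor (E := E) (R := R) Lfull.
      by rewrite LR rE rBE add1n prednK // ltnW.
    exists e => //.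
    have : e \in [set prod_pair p | p : 'cV[F]_r * 'rV[F]_r & p.2 *m p.1 == 1%:M].
      rewrite -rank1_idem -rank_LXR -eE rE eqxx -rank_LXR mulmxBr mulmxBl mulmx1.
      by rewrite -eE LR rBE eqxx.
    case/imsetP => -[a b]; rewrite inE /= => ba eab; apply/imsetP.
    exists (a, b) => //; rewrite inE /= ba -unit_pair; last exact/eqP.
    by rewrite -[a *m b]/(prod_pair (a, b)) -eab -eE EE /diff opprB addrC subrK mx_of_unit.
  rewrite inE /= => /andP[ba bDa] -> EE.
  have [h hE] := mx_of_ex (etrans (unit_pair (eqP ba)) bDa).
  have hdiff : diff (g * h^-1)%g = E.
    by rewrite /diff invMg invgK mulgKV hE EE opprB addrC subrK.
  exists (g * h^-1)%g => //; rewrite inE -rank_diff hdiff mov_diffE hdiff.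
  have /andP[r1 r2] : (\rank (a *m b) == 1%N) && (\rank (1%:M - a *m b) == r.-1).
    by rewrite rank1_idem; apply/imsetP; exists (a, b); rewrite ?inE.
  by rewrite EE rank_LXR r1 -LR -{1}[L]mulmx1 -mulmxBl -mulmxBr rank_LXR r2.
have fiber e : e \in idem -> #|[set p in pairs | prod_pair p == e]| = (q - 1)%N.
  case/imsetP => -[a b]; rewrite inE /= => /andP[/eqP ba bDa] eE.
  have a0 : a != 0 by apply: contra_eq_neq ba => ->; rewrite mulmx0 eq_sym oner_neq0.
  pose f (c : F) : 'cV[F]_r * 'rV[F]_r := (c *: a, c^-1 *: b).
  have injf : injective f.
    by move=> c d [/eqP + _]; rewrite -subr_eq0 -scalerBl scaler_eq0 (negPf a0) orbF subr_eq0 => /eqP.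
  have -> : (q - 1)%N = #|predC1 (0 : F)| by rewrite cardC1 subn1.
  rewrite -(card_image injf); apply: eq_card => -[a' b'].
  rewrite inE [in X in X && _]inE /= /prod_pair /=.
  apply/andP/imageP => [[/andP[/eqP ba' bDa'] /eqP abE]|[c]].
    have ab' : a' *m b' = a *m b by rewrite abE eE.
    set l := (b *m a') 0 0; have ba'E : b *m a' = l%:M by rewrite [LHS]mx11_scalar.
    have aE : a' = l *: a.
      by rewrite -[a']mulmx1 -ba' mulmxA ab' -mulmxA ba'E mul_mx_scalar.
    have bE : b = l *: b'.
      by rewrite -[b]mul1mx -ba -mulmxA -ab' mulmxA ba'E mul_scalar_mx.
    have l0 : l != 0.
      by apply: contra_eq_neq ba' => l0; rewrite aE l0 scale0r mulmx0 eq_sym oner_neq0.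
    by exists l; rewrite ?inE // /f bE scalerA mulVf // scale1r -aE.
  rewrite inE => c0 [-> ->].
  have scE k (X : 'M[F]_(r, k)) (Y : 'M[F]_(k, r)) :
      (c^-1 *: b) *m X *m (Y *m (c *: a)) = b *m X *m (Y *m a).
    by rewrite -!scalemxAl -!scalemxAr scalerA mulVf // scale1r.
  have := scE r 1%:M 1%:M; rewrite !mulmx1 !mul1mx => ->.
  have := scE r (invmx D) 1%:M; rewrite !mul1mx => ->.
  by rewrite ba eqxx bDa -scalemxAl -scalemxAr scalerA mulfV // scale1r eE.
rewrite -sum1_card (partition_big prod_pair (mem idem)) /=; last first.
  by move=> p pP; apply: imset_f.
rewrite (eq_bigr (fun=> (q - 1)%N)) => [|e eI]; first by rewrite sum_nat_const mulnC.
by rewrite -(fiber e eI) -sum1_card; apply: eq_bigl => p; rewrite [RHS]in_set.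
Qed.

(** For [b != 0] there are [q^(r-1)] vectors [a] with [b a = 1]. Of these, [q^(r-2)] satisfy
    [b D^-1 a = 0] if [b] is not an eigenvector of [D], and none do otherwise. The eigenvectors [b]
    of [D] correspond to the eigenvectors [b R] of [g] in the image of [g - 1]. *)
Lemma card_pairs : #|pairs| = (q ^ (r - 2) * ((q ^ r - 1) * (q - 1) + #|moved_eigen g|))%N.
Proof.
pose stable := [set b : 'rV[F]_r | (b != 0) && (b *m invmx D <= b)%MS].
have stableE (b : 'rV[F]_r) : (b *m invmx D <= b)%MS = (b *m D <= b)%MS.
  apply/idP/idP => [|/(stable_invmx Du)//].
  by rewrite -{2}[D]invmxK; apply: stable_invmx; rewrite unitmx_inv.
have card_stable : #|moved_eigen g| = #|stable|.
  have inj : injective (fun b : 'rV[F]_r => b *m R) by exact: row_free_inj.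
  rewrite -[RHS](card_imset _ inj); apply: eq_card => v.
  rewrite inE; apply/and3P/imsetP => [[vB v0 vg]|[b]].
    have /submxP[b vE] : (v <= R)%MS by rewrite eq_row_base.
    exists b => //; rewrite inE stableE; apply/andP; split.
      by apply: contra v0 => /eqP b0; rewrite vE b0 mul0mx.
    by rewrite -(submxMfree _ _ Rfree) -mulmxA -RgE mulmxA -vE.
  rewrite inE stableE => /andP[b0 bD] ->; split.
  - by rewrite -(eq_row_base B) submxMl.
  - by apply: contra b0 => /eqP bR; apply/eqP/inj; rewrite /= bR mul0mx.
  by rewrite -mulmxA RgE mulmxA submxMfree.
pose A b := [set a : 'cV[F]_r | (b *m a == 1%:M) && (b *m invmx D *m a != 0)].
have sumA : #|pairs| = (\sum_(b : 'rV[F]_r | b != 0%R) #|A b|)%N.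
  rewrite -sum1_card (partition_big snd (fun b => b != 0)) /=; last first.
    move=> [a b]; rewrite inE /= => /andP[/eqP ba _].
    by apply: contra_eq_neq ba => ->; rewrite mul0mx eq_sym oner_neq0.
  apply: eq_bigr => b _.
  have inj : injective (fun a : 'cV[F]_r => (a, b)) by move=> a a' [].
  rewrite -(card_imset _ inj) -sum1_card; apply: eq_bigl => -[a b'] /=.
  apply/andP/imsetP => [[pP /eqP /= bE]|[a' + [-> ->]]].
    by exists a; rewrite -bE //; move: pP; rewrite !inE.
  by rewrite !inE eqxx.
have cardA (b : 'rV[F]_r) : b != 0 ->
    (#|A b| + (b \notin stable) * q ^ (r - 2) = q ^ (r - 1))%N.
  move=> b0; have bfree : row_free b by rewrite /row_free rank_rV b0.
  rewrite -(card_linear_system 1%:M bfree).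
  pose S2 := [set a : 'cV[F]_r | (b *m a == 1%:M) && (b *m invmx D *m a == 0)].
  have -> : #|[set a : 'cV[F]_r | b *m a == 1%:M]| = (#|A b| + #|S2|)%N.
    rewrite -cardsUI [X in (_ + X)%N]eq_card0 ?addn0.
      by apply: eq_card => a; rewrite !inE -andb_orr orNb andbT.
    by move=> a; rewrite !inE; case: (_ *m _ == 0); rewrite ?andbF.
  congr (_ + _)%N; rewrite inE b0 /=.
  have [/sub_rVP[l lE]|npar] := boolP (b *m invmx D <= b)%MS; rewrite ?mul0n ?mul1n.
    apply/esym/eq_card0 => a; rewrite inE lE -scalemxAl; apply/negP => /andP[/eqP -> /eqP].
    move=> l1; move: lE; have -> : l = 0.
      by have /matrixP/(_ 0 0) := l1; rewrite !mxE mulr1.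
    rewrite scale0r => /(congr1 (mulmx^~ D)); rewrite mulmxKV // mul0mx => /eqP.
    by rewrite (negPf b0).
  have fr2 : row_free (col_mx b (b *m invmx D)).
    rewrite /row_free -addsmxE mxrank_disjoint_sum.
      by rewrite mxrankMfree ?row_free_unit ?unitmx_inv // rank_rV b0.
    apply/eqP/rowV0P => x; rewrite sub_capmx => /andP[xb /sub_rVP[d xE]].
    apply: contraNeq npar; rewrite xE scaler_eq0 => /norP[d0 _].
    by rewrite -[b *m _](scalerK d0) -xE scalemx_sub.
  rewrite -(card_linear_system (col_mx 1%:M 0) fr2); apply: eq_card => a.
  rewrite !inE mul_col_mx.
  by apply/eqP/andP => [/eq_col_mx[-> ->]|[/eqP -> /eqP ->]//]; rewrite !eqxx.
have q_gt1 : (1 < q)%N := card_finNzRing_gt1 F.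
have card_nz : #|[pred b : 'rV[F]_r | b != 0]| = (q ^ r - 1)%N.
  by rewrite (eq_card (B := predC1 0)) // cardC1 card_mx mul1n subn1.
have card_nstable : (\sum_(b : 'rV[F]_r | b != 0%R) (b \notin stable) + #|stable| = q ^ r - 1)%N.
  rewrite -card_nz -!sum1_card [X in (_ + X)%N](eq_bigl (fun b => (b != 0) && (b \in stable))).
    by rewrite big_mkcondr -big_split; apply: eq_bigr => b _; case: (b \in stable).
  by move=> b; rewrite inE; case: (b != 0).
have tot : (#|pairs| + (\sum_(b : 'rV[F]_r | b != 0%R) (b \notin stable)) * q ^ (r - 2) =
    (q ^ r - 1) * q ^ (r - 1))%N.
  rewrite sumA big_distrl -big_split /= -card_nz -sum_nat_const.
  by apply: eq_bigr => b; exact: cardA.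
have qr1 : (q ^ (r - 1) = q * q ^ (r - 2))%N by rewrite -expnS; congr (_ ^ _)%N; lia.
move: tot; rewrite -card_nstable qr1 card_stable.
case: (q) q_gt1 => // q1 _; rewrite subn1 /=.
move: #|pairs| #|stable| (\sum_(_ | _) _)%N (_ ^ _)%N => x y z w; lia.
Qed.

Lemma card_rank1_factors :
  ((q - 1) * #|rank1_factors| =
   q ^ (r - 2) * ((q ^ r - 1) * (q - 1) + #|moved_eigen g|))%N.
Proof. by rewrite -card_pairs_rank1 card_pairs. Qed.

End RankOneFactors.

(** * Numbers of factorizations and the merging of two parts *)

Lemma exponent_merge a b n S : (0 < a -> 0 < b -> a + b <= n ->
  2 * a * b + ((a + b - 1) * (n - (a + b)) + S) =
  n + ((a - 1) * (n - a) + ((b - 1) * (n - b) + S)))%N.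
Proof.
case: a => // a; case: b => // b _ _ le.
(* With [n] written as a sum, no truncated subtraction survives. *)
have -> : n = (a.+1 + b.+1 + (n - (a.+1 + b.+1)))%N by lia.
move: (n - _)%N => d.
have -> : (a.+1 + b.+1 - 1 = a + b.+1)%N by lia.
have -> : (a.+1 + b.+1 + d - (a.+1 + b.+1) = d)%N by lia.
have -> : (a.+1 + b.+1 + d - a.+1 = b.+1 + d)%N by lia.
have -> : (a.+1 + b.+1 + d - b.+1 = a.+1 + d)%N by lia.
rewrite !subn1 /=; ring.
Qed.

Section Factorizations.

Variables (F : finFieldType) (N : nat).
Local Notation n := N.+1.
Local Notation q := #|F|.
Local Notation GL := {'GL_N.+1[F]}.
Local Notation mx g := (@mx_of F N g).
Implicit Types (g h t k c : GL) (al be : seq nat).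

Lemma codim_fix1 : codim_fix (1%g : GL) = 0%N.
Proof. by rewrite /codim_fix /mov mx_of1 subrr mxrank0. Qed.

Lemma codim_fixM g h : (codim_fix (g * h)%g <= codim_fix g + codim_fix h)%N.
Proof.
have -> : codim_fix (g * h)%g = \rank (mov g *m mx h + mov h)%R.
  congr (\rank _); rewrite /mov mx_ofM mulmxBl mul1mx.
  by rewrite [RHS]addrA subrK.
by apply: leq_trans (mxrank_add _ _) _; rewrite leq_add2r mxrankM_maxl.
Qed.

(* Factorizations [c = g_1 ... g_m] with [codim_fix g_i] prescribed by [al]. *)
Fixpoint nfact al c : nat :=
  if al is a :: al' then (\sum_(g | codim_fix g == a) nfact al' (g^-1 * c)%g)%N
  else (c == 1%g).

Lemma nfact_seq1 a c : nfact [:: a] c = (codim_fix c == a).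
Proof.
rewrite /=; have [ca|ca] := eqVneq (codim_fix c) a.
  rewrite (bigD1 c) /=; last exact/eqP.
  rewrite mulVg eqxx big1 // => h /andP[_ hc].
  by apply/eqP; rewrite eqb0 -eq_mulVg1.
apply: big1 => h /eqP ha; apply/eqP; rewrite eqb0 -eq_mulVg1.
by apply: contra ca => /eqP <-; apply/eqP.
Qed.

Lemma nfactJ al c k : nfact al (c ^ k)%g = nfact al c.
Proof.
elim: al c => [|a al IH] c /=.
  by rewrite conjg_eq1.
rewrite (reindex_inj (conjg_inj k)) /=; apply: eq_big => g.
  by rewrite codim_fixJ.
by rewrite -conjVg -conjMg IH.
Qed.

(** The Hurwitz move [g * h ^ g = h * g] exchanges the ranks of two adjacent factors. *)
Lemma nfact_swap a b al c : nfact [:: a, b & al] c = nfact [:: b, a & al] c.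
Proof.
rewrite /= [RHS](exchange_big_dep (fun g => codim_fix g == a)) //=.
apply: eq_bigr => g ga; rewrite (reindex_inj (conjg_inj g)) /=.
apply: eq_big => h; first by rewrite codim_fixJ ga andbT.
move=> _; congr nfact; rewrite !mulgA -!invMg; congr (_^-1 * _)%g.
by rewrite -conjgC.
Qed.

Lemma nfact_codim al c : (0 < nfact al c)%N -> (codim_fix c <= sumn al)%N.
Proof.
elim: al c => [|a al IH] c /=; first by rewrite lt0b => /eqP ->; rewrite codim_fix1.
rewrite lt0n sum_nat_eq0 negb_forall => /existsP[g]; rewrite negb_imply.
move=> /andP[/eqP <-]; rewrite -lt0n => /IH le.
rewrite -[c in codim_fix c](mulKVg g); apply: leq_trans (codim_fixM _ _) _.
by rewrite leq_add2l.
Qed.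

Variable c : GL.
Hypotheses (c_irr : irreducible_mx (mx c)) (c_fix : codim_fix c = n).

(** Grouped by the product [g] of the first two factors, the left side weights each [g] of rank [r]
    by its number of rank-one factors, an affine function of the number of eigenvectors in the image
    of [g - 1]. The average of the latter is known, the weight [nfact be h] of the remaining product
    [h] being a class function. *)
Lemma nfact_split1 r be : (1 < r)%N -> (r + sumn be = n)%N ->
  (q ^ sumn be * nfact [:: 1, r.-1 & be] c =
   q ^ (r - 2) * (q ^ n - 1) * nfact (r :: be) c)%N.
Proof.
move=> r_gt1 rn; set s := sumn be.
have q_gt1 : (1 < q)%N := card_finNzRing_gt1 F.
have codim_ge g : (0 < nfact be (g^-1 * c)%g)%N -> (r <= codim_fix g)%N.
  move=> /nfact_codim le; have := codim_fixM g (g^-1 * c)%g.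
  by rewrite mulKVg c_fix; move: le rn; rewrite -/s; lia.
have split_sum : nfact [:: 1, r.-1 & be]%N c =
    (\sum_(g | codim_fix g == r) nfact be (g^-1 * c)%g * #|rank1_factors g|)%N.
  rewrite /=; transitivity (\sum_(t | codim_fix t == 1%N)
     \sum_(g | codim_fix (t^-1 * g)%g == r.-1) nfact be (g^-1 * c)%g)%N.
    apply: eq_bigr => t _; rewrite [RHS](reindex_inj (mulgI t)) /=.
    by apply: eq_big => g; rewrite ?mulKg // invMg mulgA.
  rewrite (exchange_big_dep predT) //= (bigID (fun g => codim_fix g == r)) /=.
  rewrite [X in (_ + X)%N]big1 ?addn0.
    apply: eq_bigr => g /eqP gr; rewrite sum_nat_cond_const mulnC; congr (_ * _)%N.
    apply: eq_card => t; rewrite !inE -/(codim_fix g) gr //.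
  move=> g gr; apply: big1 => t /andP[/eqP t1 /eqP tg]; apply/eqP.
  rewrite -leqn0 leqNgt; apply: contra gr => /codim_ge le.
  have := codim_fixM t (t^-1 * g)%g; rewrite mulKVg t1 tg add1n prednK ?(ltnW r_gt1) //.
  by rewrite eqn_leq le andbT.
(* Substitution [g = c * h^-1]. A term with [nfact be h] nonzero has [codim_fix h <= s], and
   subadditivity applied to [c] forces equality. *)
have to_good (f : GL -> nat) :
    (\sum_(g | codim_fix g == r) nfact be (g^-1 * c)%g * f g =
     \sum_(h | (codim_fix h == s) && (codim_fix (c * h^-1)%g == r))
        nfact be h * f (c * h^-1)%g)%N.
  rewrite (reindex_inj (inj_comp (mulgI c) invg_inj)) /=.
  rewrite [RHS]big_mkcondl; apply: eq_bigr => h hr.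
  rewrite invMg invgK mulgKV; case: eqP => // hs; apply/eqP.
  rewrite muln_eq0 -leqn0 leqNgt; apply/orP; left; apply/negP => hp.
  have := nfact_codim hp; have := codim_fixM (c * h^-1)%g h.
  by rewrite mulgKV c_fix (eqP hr) -/s => *; apply: hs; lia.
have tot : (nfact (r :: be) c =
    \sum_(h | (codim_fix h == s) && (codim_fix (c * h^-1)%g == r)) nfact be h)%N.
  have := to_good (fun=> 1%N); under eq_bigr do rewrite muln1.
  by move=> /= ->; under eq_bigr do rewrite muln1.
have avg := @sum_moved_eigen F N c c_irr c_fix s r (etrans (addnC _ _) rn) r_gt1
              (nfact be) (nfactJ be).
apply/eqP; rewrite -(eqn_pmul2l (_ : 0 < q - 1)%N); last by rewrite subn_gt0.
apply/eqP; rewrite split_sum to_good mulnCA [((q - 1) * _)%N]mulnC big_distrl /=.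
transitivity (q ^ (r - 2) * ((q ^ r - 1) * (q - 1) * (q ^ s * nfact (r :: be) c)
   + q ^ s * \sum_(h | (codim_fix h == s) && (codim_fix (c * h^-1)%g == r))
        nfact be h * #|moved_eigen (c * h^-1)%g|))%N.
  rewrite mulnCA -mulnDr mulnCA; congr (_ * _)%N.
  rewrite tot !big_distrr /= -big_split /= big_distrr /=; apply: eq_bigr => h /andP[_ /eqP hr].
  have := @card_rank1_factors F N (c * h^-1)%g; rewrite -/(codim_fix _) hr => /(_ r_gt1) E.
  by rewrite -mulnA [(#|_| * _)%N]mulnC E; ring.
have -> : (q ^ n = q ^ r * q ^ s)%N by rewrite -expnD rn.
(* The rest is [(q^r - 1) q^s + (q^s - 1) = q^n - 1]. *)
rewrite avg -tot -/(nfact (r :: be) c).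
have : (0 < q ^ s)%N by rewrite expn_gt0 ltnW.
have : (0 < q ^ r)%N by rewrite expn_gt0 ltnW.
move: (q ^ s)%N (q ^ r)%N (q - 1)%N (q ^ (r - 2))%N (nfact _ c) => x y z w v y0 x0.
case: x x0 => // x _; case: y y0 => // y _.
have -> : (y.+1 * x.+1 - 1 = y * x + y + x)%N by lia.
rewrite !subn1 /=; ring.
Qed.

(** Induction on [a]: in the type [1, a, b, ..] the part 1 can be merged with [a] or, by symmetry,
    with [b]. Comparing the two results relates [a + 1, b] to [a, b + 1], to which the induction
    hypothesis applies. *)
Lemma nfact_split a b be : (0 < a)%N -> (0 < b)%N -> (a + b + sumn be = n)%N ->
  (q ^ n * nfact [:: a, b & be] c =
   q ^ (2 * a * b) * (q ^ n - 1) * nfact (a + b :: be)%N c)%N.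
Proof.
have q_gt1 : (1 < q)%N := card_finNzRing_gt1 F.
have q_gt0 := ltnW q_gt1.
have qX_gt0 m : (0 < q ^ m)%N by rewrite expn_gt0 q_gt0.
have split1 b' be' : (0 < b')%N -> (b'.+1 + sumn be' = n)%N ->
    (q ^ n * nfact [:: 1, b' & be'] c = q ^ (2 * b') * (q ^ n - 1) * nfact (b'.+1 :: be') c)%N.
  move=> b0 bn; have := nfact_split1 (r := b'.+1) b0 bn => /= H.
  have -> : (q ^ n = q ^ b'.+1 * q ^ sumn be')%N by rewrite -expnD bn.
  rewrite -mulnA H -expnD bn !mulnA -expnD; congr (q ^ _ * _ * _)%N.
  by move: b0; lia.
elim: a b be => // a IH b be _ b0 abn.
have [a0|a0] := posnP a.
  by move: abn; rewrite a0 add1n muln1 => abn; apply: split1.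
have qn1 : (0 < q ^ n - 1)%N.
  by rewrite subn_gt0 -(exp1n n) ltn_exp2r.
have S1 : (q ^ n * nfact [:: 1, a, b & be] c =
    q ^ (2 * a) * (q ^ n - 1) * nfact [:: a.+1, b & be] c)%N.
  by apply: split1 => //=; move: abn; lia.
have S2 : (q ^ n * nfact [:: 1, a, b & be] c =
    q ^ (2 * b) * (q ^ n - 1) * nfact [:: a, b.+1 & be] c)%N.
  have -> : nfact [:: 1, a, b & be]%N c = nfact [:: 1, b, a & be]%N c.
    apply: eq_bigr => g _; exact: nfact_swap.
  rewrite (nfact_swap a b.+1); apply: split1 => //=; move: abn; lia.
have S3 : (q ^ (2 * a) * nfact [:: a.+1, b & be] c =
    q ^ (2 * b) * nfact [:: a, b.+1 & be] c)%N.
  apply/eqP; rewrite -(eqn_pmul2r qn1) mulnAC -S1 S2 mulnAC //.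
have S4 := IH b.+1 be a0 isT; rewrite addnS -addSn in S4.
apply/eqP; rewrite -(eqn_pmul2l (qX_gt0 (2 * a)%N)) mulnCA S3 mulnCA S4 //.
rewrite !mulnA -!expnD; apply/eqP; congr (q ^ _ * _ * _)%N; lia.
Qed.

Lemma nfact_formula al : (0 < size al)%N -> all (leq 1) al -> sumn al = n ->
  nfact al c = (q ^ (\sum_(a <- al) (a - 1) * (n - a)) * (q ^ n - 1) ^ (size al - 1))%N.
Proof.
have q_gt1 : (1 < q)%N := card_finNzRing_gt1 F.
have [m] := ubnP (size al); elim: m al => // m IH [|a [|b be]] //=.
  move=> _ _ _; rewrite addn0 => an.
  rewrite -/(nfact [:: a] c) nfact_seq1 big_seq1 an subnn muln0 mul1n c_fix eqxx //.
move=> lem _ /and3P[a0 b0 be0] abn.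
have qn0 : (0 < q ^ n)%N by rewrite expn_gt0 ltnW.
apply/eqP; rewrite -(eqn_pmul2l qn0); apply/eqP.
have -> : (\sum_(g | codim_fix g == a) \sum_(g0 | codim_fix g0 == b)
      nfact be (g0^-1 * (g^-1 * c))%g)%N = nfact [:: a, b & be] c by [].
rewrite nfact_split //; last by rewrite -addnA.
rewrite IH //=; first last.
- by rewrite -addnA.
- by rewrite be0 addn_gt0 a0.
rewrite !subSS !subn0 mulnACA -expnD -expnS [RHS]mulnA -expnD.
rewrite !big_cons; congr (q ^ _ * _)%N.
have ab_le : (a + b <= n)%N by rewrite -abn; lia.
exact: exponent_merge.
Qed.

End Factorizations.

(** * From reflection length and chains to ranks and factorizations *)

Section AbsoluteOrder.

Variables (F : finFieldType) (N : nat).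
Local Notation n := N.+1.
Local Notation q := #|F|.
Local Notation GL := {'GL_N.+1[F]}.
Local Notation mx g := (@mx_of F N g).
Implicit Types (g h t k c : GL).

Lemma reflection_codim t : reflection t -> (codim_fix t <= 1)%N.
Proof.
pose f := (gl_lin t - \1%VF)%R; move=> /eqP tr.
have dim1 : \dim (limg f) = 1%N.
  have := limg_ker_dim f fullv; rewrite capfv -/(fixedSpace _) => fE.
  by move: tr; rewrite -fE addKn.
have fE (v : 'cV[F]_n) : f v = mov t *m v.
  by rewrite add_lfunE opp_lfunE id_lfunE /gl_lin lfunE /= /mov mulmxBl mul1mx.
have [w w0 wf] : exists2 w : 'cV[F]_n, w != 0 & limg f = <[w]>%VS.
  exists (vpick (limg f)); first by rewrite vpick0 -dimv_eq0 dim1.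
  apply/esym/eqP; rewrite eqEdim -memvE memv_pick dim1 dim_vline vpick0.
  by rewrite -dimv_eq0 dim1.
have colw j : exists a : F, col j (mov t) = a *: w.
  by apply/vlineP; rewrite -wf colE -fE memv_img ?memvf.
have {}colw j : {a : F | col j (mov t) == a *: w}.
  by apply: sigW; case: (colw j) => a ->; exists a.
rewrite /codim_fix (_ : mov t = w *m \row_j sval (colw j)).
  by apply: leq_trans (mxrankM_maxl _ _) _; apply: rank_leq_col.
apply/matrixP => i j; rewrite [RHS]mxE big_ord1 [_ 0 j]mxE mulrC.
by have /eqP/colP/(_ i) := svalP (colw j); rewrite [LHS]mxE [RHS]mxE.
Qed.

(** A reflection can always be split off so that the rank of [g - 1] drops, which bounds the length
    above; the lower bound is subadditivity of the rank. *)
Lemma refl_lengthE g : refl_length g = codim_fix g.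
Proof.
rewrite /refl_length; case: ex_minnP => l /existsP[s /andP[sT /eqP gE]] lmin.
apply/eqP; rewrite eqn_leq; apply/andP; split.
  suff [l' le /lmin /leq_trans -> //] : exists2 l', (l' <= codim_fix g)%N & reflection_word g l'.
  have [r] := ubnP (codim_fix g); elim: r g {s sT gE lmin} => // r IH g.
  have [->|/reflection_step[t [h [tT gth lth]]]] := eqVneq g 1%g.
    by exists 0%N => //; apply/existsP; exists [tuple]; rewrite big_nil eqxx.
  rewrite ltnS => /(leq_trans lth)/IH[l' le /existsP[s /andP[sT /eqP hE]]].
  exists l'.+1; first exact: leq_ltn_trans le lth.
  by apply/existsP; exists [tuple of t :: s]; rewrite /= tT sT big_cons -hE gth eqxx.
rewrite gE -[X in (_ <= X)%N](size_tuple s); elim: (tval s) sT => [|t s' IH] /=.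
  by rewrite big_nil codim_fix1.
case/andP => tT s'T; rewrite big_cons; apply: leq_trans (codim_fixM _ _) _.
exact: (leq_add (reflection_codim tT) (IH s'T)).
Qed.

(** Passage from the column to the row action: if the row space of [Z] is stable under [c], so is
    its annihilator, the kernel of [v |-> Z *m v]. *)
Lemma regular_elliptic_irreducible c : regular_elliptic c -> irreducible_mx (mx c).
Proof.
move=> c_reg Z ZcZ; pose f : 'Hom('cV[F]_n, 'cV[F]_n) := linfun (mulmx Z).
have fE (v : 'cV[F]_n) : f v = Z *m v by rewrite lfunE.
have cE (v : 'cV[F]_n) : gl_lin c v = mx c *m v by rewrite lfunE.
have [|U0|UT] := c_reg (lker f).
- apply/subvP => x /memv_imgP[v]; rewrite !memv_ker fE cE => /eqP Zv ->.
  case/submxP: ZcZ => Y ZY.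
  by rewrite fE mulmxA ZY -mulmxA Zv mulmx0.
- right; apply/eqP; rewrite eqn_leq rank_leq_col leqNgt; apply/negP => rZ.
  have [u [phi [Zphi uphi]]] := ex_functional rZ.
  have : phi \in lker f by rewrite memv_ker fE Zphi.
  rewrite U0 memv0 => /eqP phi0; move: uphi; rewrite phi0 mulmx0.
  by move=> /matrixP/(_ 0 0); rewrite !mxE => /eqP; rewrite eq_sym oner_eq0.
left; apply/matrixP => i j.
have : delta_mx j 0 \in lker f by rewrite UT memvf.
rewrite memv_ker fE -colE => /eqP/colP/(_ i).
by rewrite !mxE.
Qed.

Lemma irreducible_codim c : irreducible_mx (mx c) -> c != 1%g -> codim_fix c = n.
Proof.
move=> c_irr c1; have [|K0|rK] := c_irr (kermx (mov c)).
- have : kermx (mov c) *m mov c = 0 by apply: mulmx_ker.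
  by rewrite mulmxBr mulmx1 => /eqP; rewrite subr_eq0 => /eqP ->.
- have := mxrank_ker (mov c); rewrite K0 mxrank0 -/(codim_fix c) => /esym/eqP.
  by rewrite subn_eq0 => le; apply/eqP; rewrite eqn_leq le rank_leq_col.
have := mxrank_ker (mov c); rewrite rK -/(codim_fix c) => rE.
have : codim_fix c = 0%N by have : (codim_fix c <= n)%N := rank_leq_col _; lia.
move/eqP; rewrite mxrank_eq0 subr_eq0 => /eqP mc1.
by case/eqP: c1; apply: mx_of_inj.
Qed.

Definition step_chains m (a : m.-tuple nat) c : {set {ffun 'I_m.+1 -> GL}} :=
  [set x : {ffun 'I_m.+1 -> GL} | [&& x ord0 == 1%g, x ord_max == c &
    [forall i : 'I_m, codim_fix ((x (widen_ord (leqnSn m) i))^-1 *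
                                 x (lift ord0 i))%g == tnth a i]]].

(** A chain consists of the partial products of a factorization; removing the first factor [g] and
    translating the rest by [g^-1] gives the recursion of [nfact]. *)
Lemma card_step_chains m (a : m.-tuple nat) c : #|step_chains a c| = nfact a c.
Proof.
elim: m a c => [|m IH] a c.
  rewrite tuple0 /=; have [->|c1] := eqVneq c 1%g.
    rewrite (_ : step_chains _ _ = [set [ffun=> 1%g]]) ?cards1 //.
    apply/setP => x; rewrite !inE; apply/and3P/eqP => [[/eqP x0 _ _]|->].
      by apply/ffunP => i; rewrite ffunE [i]ord1.
    by rewrite !ffunE; split=> //; apply/forallP => -[].
  apply: eq_card0 => x; rewrite inE; apply/negP => /and3P[/eqP x0 /eqP xc _].
  by case/eqP: c1; rewrite -xc -x0; congr (x _); apply/val_inj.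
case/tupleP: a => a0 a /=.
rewrite -sum1_card (partition_big (fun x : {ffun 'I_m.+2 -> GL} => x (lift ord0 ord0))
   (fun g => codim_fix g == a0)) /=; last first.
  move=> x; rewrite inE => /and3P[/eqP x0 _ /forallP/(_ ord0)].
  by rewrite tnth0 (_ : widen_ord _ _ = ord0) ?x0 ?invg1 ?mul1g //; apply/val_inj.
apply: eq_bigr => g ga; rewrite -IH -sum1_card.
pose ext (y : {ffun 'I_m.+1 -> GL}) : {ffun 'I_m.+2 -> GL} :=
  [ffun i => if unlift ord0 i is Some j then (g * y j)%g else 1%g].
pose res (x : {ffun 'I_m.+2 -> GL}) : {ffun 'I_m.+1 -> GL} :=
  [ffun j => (g^-1 * x (lift ord0 j))%g].
have ext0 y : ext y ord0 = 1%g by rewrite ffunE unlift_none.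
have extS y j : ext y (lift ord0 j) = (g * y j)%g by rewrite ffunE liftK.
have resK y : res (ext y) = y.
  by apply/ffunP => j; rewrite ffunE extS mulKg.
rewrite (reindex_onto ext res) /=; last first.
  move=> x /andP[]; rewrite inE => /and3P[/eqP x0 _ _] _; apply/ffunP => i.
  rewrite ffunE; case: unliftP => [j ->|->]; last by rewrite x0.
  by rewrite ffunE mulKVg.
apply: eq_bigl => y; rewrite resK eqxx andbT !inE ext0 eqxx extS /=.
have -> : ord_max = lift ord0 (ord_max : 'I_m.+1) by apply/val_inj.
rewrite extS -(can2_eq (mulKg g) (mulKVg g)) [RHS]andbC -andbA.
have widenS (j : 'I_m) : widen_ord (leqnSn m.+1) (lift ord0 j) = lift ord0 (widen_ord (leqnSn m) j).
  by apply/val_inj.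
have wid0 : widen_ord (leqnSn m.+1) ord0 = ord0 by apply/val_inj.
have forallS (P : pred 'I_m.+1) :
    [forall i, P i] = P ord0 && [forall j, P (lift ord0 j)].
  apply/forallP/andP => [PT|[P0 /forallP PS] i]; first by split=> //; apply/forallP.
  by case: (unliftP ord0 i) => [j|] ->.
rewrite forallS wid0 ext0 extS invg1 mul1g tnth0.
have -> : (g * y ord0 == g)%g = (y ord0 == 1%g).
  by rewrite -[X in _ == X]mulg1 (inj_eq (mulgI g)).
have [->|_] := eqVneq (y ord0) 1%g; last by rewrite !andbF.
rewrite mulg1 ga !andbT /=; congr (_ && _).
apply: eq_forallb => j.
by rewrite widenS !extS tnthS invMg -mulgA mulKg.
Qed.

(** By subadditivity, prescribed step ranks bound the rank of [c_k] by the partial sum [S k] and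
    that of [c_k^-1 c] by [n - S k]. As [c] has rank [n], both bounds are attained, so the chain is
    increasing with the required lengths. *)
Lemma rank_chainsE m (a : m.-tuple nat) c : is_composition n a -> codim_fix c = n ->
  rank_chains a c = step_chains a c.
Proof.
move=> /andP[/forallP a_gt0 /eqP a_sum] c_fix.
pose S (k : nat) := (\sum_(j < m | j < k) tnth a j)%N.
have S0 : S 0%N = 0%N by apply: big1.
have Sm : S m = n by rewrite -a_sum; apply: eq_bigl => j; rewrite ltn_ord.
have SS (i : 'I_m) : S i.+1 = (S i + tnth a i)%N.
  rewrite /S (bigD1 i) //= addnC; congr (_ + _)%N; apply: eq_bigl => j.
  by rewrite ltnS [RHS]ltn_neqAle andbC.
apply/setP => x; rewrite !in_set; apply/and4P/and3P.
  case=> x0 xc /forallP lt_x /forallP len_x; split=> //; apply/forallP => i.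
  have /andP[/eqP le_x _] := lt_x i.
  have lift_x : codim_fix (x (lift ord0 i)) = S i.+1.
    by rewrite -refl_lengthE (eqP (len_x _)).
  have widen_x : codim_fix (x (widen_ord (leqnSn m) i)) = S i.
    by rewrite -refl_lengthE (eqP (len_x _)).
  by move: le_x; rewrite !refl_lengthE lift_x widen_x SS => /addnI ->.
case=> x0 xc /forallP st_x.
pose y (k : nat) := x (inord k).
have yw (i : 'I_m) : y i = x (widen_ord (leqnSn m) i).
  by congr (x _); apply/val_inj; rewrite /= inordK // ltnW // ltnS.
have yl (i : 'I_m) : y i.+1 = x (lift ord0 i).
  by congr (x _); apply/val_inj; rewrite /= inordK // ltnS.
have yE (i : 'I_m.+1) : y i = x i by rewrite /y inord_val.
have y0 : y 0%N = 1%g by rewrite (yE ord0) (eqP x0).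
have ym : y m = c by rewrite (yE ord_max) (eqP xc).
have gap (k d : nat) : (k + d <= m)%N -> (codim_fix ((y k)^-1 * y (k + d))%g + S k <= S (k + d))%N.
  elim: d => [|d IH] le; first by rewrite addn0 mulVg codim_fix1.
  have lt : (k + d < m)%N by rewrite -addnS.
  have := st_x (Ordinal lt); rewrite -yw -yl /= -addnS => /eqP stE.
  have := SS (Ordinal lt); rewrite /= -addnS -stE => ->.
  have -> : ((y k)^-1 * y (k + d.+1) =
             ((y k)^-1 * y (k + d)) * ((y (k + d))^-1 * y (k + d.+1)))%g.
    by rewrite mulgA mulgK.
  apply: leq_trans (leq_add (codim_fixM _ _) (leqnn _)) _.
  by rewrite addnAC leq_add2r IH // ltnW.
have y_fix (k : nat) : (k <= m)%N -> codim_fix (y k) = S k.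
  move=> km; have := gap 0%N k km; have := gap k (m - k)%N.
  rewrite add0n S0 y0 invg1 mul1g addn0 subnKC // ym Sm => /(_ (leqnn m)) h1 h2.
  apply/eqP; rewrite eqn_leq h2 /=.
  have := codim_fixM (y k) ((y k)^-1 * c)%g; rewrite mulKVg c_fix.
  lia.
have step_fix (i : 'I_m) :
    (codim_fix (y i) + codim_fix ((y i)^-1 * y i.+1)%g)%N = codim_fix (y i.+1).
  have lt_im := ltn_ord i.
  rewrite (y_fix _ (ltnW lt_im)) (y_fix _ lt_im) SS; congr (_ + _)%N.
  by rewrite yw yl (eqP (st_x i)).
split=> //; apply/forallP => i.
  rewrite /abs_lt /abs_le !refl_lengthE -yw -yl step_fix eqxx /=.
  apply/eqP => yy; have := step_fix i; rewrite yw yl (eqP (st_x i)) -yw -yl yy.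
  by have := a_gt0 i; lia.
by rewrite refl_lengthE -yE y_fix // -ltnS.
Qed.

End AbsoluteOrder.

Theorem theorem4p2 (F : finFieldType) (n : nat) (n_gt0 : (0 < n)%N)
    (c : {'GL_n[F]}) (c_reg : regular_elliptic c)
    (* only excludes c = 1 for n = 1: no regular elliptic c is 1 for n >= 2 *)
    (c_neq1 : c <> 1%g) :
  (forall (m : nat) (a : m.-tuple nat), is_composition n a ->
     flag_f a c = (#|F| ^ eps n a * (#|F| ^ n - 1) ^ (m - 1))%N) /\
  (forall k : nat, (1 <= k <= n - 1)%N ->
     #|[set g in abs_interval 1%g c | refl_length g == k]|
       = flag_f [tuple k; (n - k)%N] c /\
     flag_f [tuple k; (n - k)%N] c
       = (#|F| ^ (2 * k * (n - k) - n) * (#|F| ^ n - 1))%N).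
Proof.
case: n n_gt0 c c_reg c_neq1 => // N _ c c_reg /eqP c_neq1.
have c_irr := regular_elliptic_irreducible c_reg.
have c_fix := irreducible_codim c_irr c_neq1.
have flagE (m : nat) (a : m.-tuple nat) : is_composition N.+1 a -> flag_f a c = nfact a c.
  by move=> a_comp; rewrite /flag_f rank_chainsE // card_step_chains.
have count (m : nat) (a : m.-tuple nat) : is_composition N.+1 a ->
    flag_f a c = (#|F| ^ eps N.+1 a * (#|F| ^ N.+1 - 1) ^ (m - 1))%N.
  move=> a_comp; rewrite flagE //; have /andP[/forallP a_gt0 /eqP a_sum] := a_comp.
  have sum_a : sumn a = N.+1 by rewrite sumnE big_tuple.
  rewrite (nfact_formula c_irr c_fix) //.
  - by rewrite size_tuple big_tuple.
  - by case: (tval a) sum_a.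
  by apply/all_tnthP.
split=> // k /andP[k_gt0 k_le].
have comp2 : is_composition N.+1 [tuple k; (N.+1 - k)%N].
  apply/andP; split; first by apply/forallP => -[[|[|]]] //= *; rewrite /tnth /=; lia.
  by rewrite -(big_tuple _ _ [tuple k; (N.+1 - k)%N] xpredT id) !big_cons big_nil /=; lia.
split.
  rewrite flagE // -sum1_card [RHS]/= big_mkcond [RHS]big_mkcond /=.
  apply: eq_bigr => g _; rewrite -/(nfact [:: _] _) nfact_seq1.
  (* For the type [k, n - k] the second factor is determined by the first, and its rank condition is
     [g <= c]. *)
  rewrite !in_set /abs_le !refl_lengthE codim_fix1 invg1 mul1g add0n eqxx c_fix /=.
  rewrite andbC; have [gk|//] := eqVneq (codim_fix g) k.
  have -> : (codim_fix (g^-1 * c)%g == N.+1 - k)%N = (k + codim_fix (g^-1 * c)%g == N.+1)%N.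
    by apply/eqP/eqP; lia.
  by rewrite gk; case: (_ == _).
rewrite count // subSS subn0 expn1; congr (_ ^ _ * _)%N.
rewrite /eps -(big_tuple _ _ [tuple k; (N.+1 - k)%N] xpredT (fun x => (x - 1) * (N.+1 - x))%N) !big_cons big_nil /=.
(* The exponents agree because [(k-1)(n-k) + (n-k-1)k = 2k(n-k) - n]; writing [n = k + d + 1]
   removes the truncated subtractions. *)
have [d dE] : {d | N.+1 = (k + d.+1)%N} by exists (N - k)%N; lia.
rewrite dE; case: k k_gt0 {k_le comp2 dE} => // k _.
rewrite addKn addnK !subn1 /=; lia.
Qed.
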